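(* Let $p\in[1,2]$ and let $H$ be a finitely generated infinite group. Then the equivariant $L_p$-compression exponent of the wreath product $H\wr\mathbb Z$ is $$\alpha_p^{\#}(H\wr\mathbb Z)=\min\left\{\frac{\alpha_p^{\#}(H)}{\alpha_p^{\#}(H)+\left(1-\frac1p\right)},\ \alpha_p^{\#}(H)\right\},$$ where, if $p=1$ and $\alpha_1^{\#}(H)=0$, the fraction $0/0$ is read as $1$ (so that for $p=1$ the formula reads $\alpha_1^{\#}(H\wr\mathbb Z)=\alpha_1^{\#}(H)$).
   Context: $H\wr\mathbb Z=H^{(\mathbb Z)}\rtimes\mathbb Z$, where $H^{(\mathbb Z)}$ is the group of finitely supported functions $\mathbb Z\to H$ and $\mathbb Z$ acts by translation. $L_p=L_p([0,1])$ with Lebesgue measure. For a finitely generated group $G$ with word metric $|\cdot|_G$ and a map $\Psi:G\to L_p$, $\rho_\Psi(t)=\inf\{\|\Psi(x)-\Psi(y)\|_p:|x^{-1}y|_G\ge t\}$ and $\alpha_p(\Psi)=\sup\{\alpha\ge0:\exists c>0,\ \rho_\Psi(t)\ge ct^\alpha\ \forall t\ge1\}$ (with $\sup\emptyset=0$). The equivariant compression exponent $\alpha_p^{\#}(G)$ is the supremum of $\alpha_p(\Psi)$ over all Lipschitz $G$-equivariant maps $\Psi$, i.e. maps $\Psi(g)=\tau(g)v$ for some action $\tau$ of $G$ on $L_p$ by affine isometries and some $v\in L_p$. *)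

(* Defs.v *)
From HB Require Import structures.
From mathcomp Require Import all_boot all_order all_algebra.
From mathcomp Require Import finmap.
From mathcomp Require Import all_classical all_reals all_analysis.
From mathcomp Require Import measurable_realfun ess_sup_inf hoelder.
Import Order.TTheory GRing.Theory Num.Theory.
Import numFieldNormedType.Exports.
Set Implicit Arguments. Unset Strict Implicit. Unset Printing Implicit Defensive.
Local Open Scope classical_set_scope.
Local Open Scope ring_scope.

(* The library's LspaceType (classes of functions modulo equality a.e.) carries
   no algebraic structure; below it is made a normed module by transport from
   LfunType, with norm the library's 'N[mu]_p.  The repacking in Lspace_repr and
   Lspace_class is needed because R and measurableTypeR R are distinct
   measurable types with the same Borel sets. *)
Section LspaceNormed.
Context d (T : measurableType d) (R : realType).
Variables (mu : {measure set T -> \bar R}) (p : \bar R) (p1 : (1 <= p)%E).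
Local Notation LT := (LfunType mu p1).
Local Notation V := (LspaceType mu p1).
Local Notation Q := {mfun_ mu, T >-> measurableTypeR R}.
Local Notation ae f g := ((f : T -> R) = (g : T -> R) %[ae mu]).

Lemma ae_eq_Lnorm (f g : T -> R) :
  measurable_fun setT f -> measurable_fun setT g -> ae f g ->
  'N[mu]_p[EFin \o f]%E = 'N[mu]_p[EFin \o g]%E.
Proof.
move=> mf mg fg; rewrite unlock /Lnorm.
have mp (h : T -> R) (r : R) : measurable_fun setT h ->
    measurable_fun setT (fun x => (`|(h x)%:E| `^ r)%E).
  move=> mh; apply/measurable_EFinP.
  apply: (measurableT_comp (measurable_powR _)) => //.
  exact: measurableT_comp.
case: p p1 => [r r1| _|//].
- congr (_ `^ _)%E; apply: ae_eq_integral => //; [exact: mp|exact: mp|].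
  by apply: filterS fg => x /= h xT; rewrite h.
- case: ifPn => // mu0; apply: eq_ess_sup.
  by apply: filterS fg => x /= h; rewrite h.
Qed.

Lemma Lspace_Lfun (f : V) : ((f : Q) : T -> R) \in Lfun mu p.
Proof.
rewrite inE; apply/andP; split; rewrite inE /=.
  exact: (measurable_funPT (repr (f : Q))).
exact: (@Lebesgue_finite _ _ _ _ _ p1 f).
Qed.

Definition Lspace_repr (f : V) : LT := Lfun_Sub p1 (Lspace_Lfun f).

Section class.
Variable f : LT.
Let g : T -> measurableTypeR R := f.
Let mg : measurable_fun setT g.
Proof. exact: (measurable_funPT f). Qed.
HB.instance Definition _ := isMeasurableFun.Build _ _ _ _ g mg.

Let h : Q := \pi_Q%qT (g : {mfun T >-> measurableTypeR R}).

Lemma repr_pi : ae (repr h) f.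
Proof. by have /eqP := reprK h; rewrite eqmodE => /asboolP. Qed.

Lemma pi_finite : finite_norm mu p h.
Proof.
rewrite /finite_norm (ae_eq_Lnorm _ _ repr_pi).
- exact: Lfunction_finite.
- exact: (measurable_funPT (repr h)).
- exact: (measurable_funPT f).
Qed.
HB.instance Definition _ := isFinLebesgue.Build d T R mu p p1 h pi_finite.
Definition Lspace_class : V := h.

Lemma repr_class : ae (Lspace_repr Lspace_class) f.
Proof. exact: repr_pi. Qed.

End class.

Lemma LspaceP (f g : V) : ae (Lspace_repr f) (Lspace_repr g) -> f = g.
Proof.
case: f g => [f [[fP]]] [g [[gP]]]; rewrite /Lspace_repr /= => fg.
have fgE : f = g.
  rewrite -[f]reprK -[g]reprK.
  by apply/eqP; rewrite eqmodE; apply/asboolP.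
by move: gP {fg}; rewrite -fgE => gP; rewrite (Prop_irrelevance fP gP).
Qed.

Lemma Lspace_classP (f g : LT) : ae f g -> Lspace_class f = Lspace_class g.
Proof.
move=> fg; apply: LspaceP.
apply: (ae_eq_trans (repr_class f)); apply: (ae_eq_trans fg).
exact/ae_eq_sym/repr_class.
Qed.

Lemma Lspace_reprK : cancel Lspace_repr Lspace_class.
Proof. by move=> f; apply: LspaceP; exact: repr_class. Qed.

Definition Lspace_add (f g : V) : V :=
  Lspace_class (Lspace_repr f + Lspace_repr g).
Definition Lspace_opp (f : V) : V := Lspace_class (- Lspace_repr f).
Definition Lspace_scale (a : R) (f : V) : V :=
  Lspace_class (a *: Lspace_repr f).
Definition Lspace_norm (f : V) : R := fine 'N[mu]_p[EFin \o Lspace_repr f]%E.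

Lemma Lspace_addE (f g : LT) :
  Lspace_add (Lspace_class f) (Lspace_class g) = Lspace_class (f + g).
Proof.
apply: Lspace_classP; apply: filterS2 (repr_class f) (repr_class g).
by move=> x fx gx xT; rewrite -[RHS]/(f x + g x) -(fx xT) -(gx xT).
Qed.

Lemma Lspace_oppE (f : LT) :
  Lspace_opp (Lspace_class f) = Lspace_class (- f).
Proof.
apply: Lspace_classP; apply: filterS (repr_class f) => x fx xT.
by rewrite -[RHS]/(- f x) -(fx xT).
Qed.

Lemma Lspace_scaleE a (f : LT) :
  Lspace_scale a (Lspace_class f) = Lspace_class (a *: f).
Proof.
apply: Lspace_classP; apply: filterS (repr_class f) => x fx xT.
by rewrite -[RHS]/(a * f x) -(fx xT).
Qed.

Lemma Lspace_normE (f : LT) :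
  Lspace_norm (Lspace_class f) = fine 'N[mu]_p[EFin \o f]%E.
Proof.
congr fine; apply: ae_eq_Lnorm (repr_class f); exact: measurable_funPT.
Qed.

Fact Lspace_addA : associative Lspace_add.
Proof.
move=> f g h; rewrite -[f]Lspace_reprK -[g]Lspace_reprK -[h]Lspace_reprK.
by rewrite !Lspace_addE addrA.
Qed.
Fact Lspace_addC : commutative Lspace_add.
Proof. by move=> f g; congr Lspace_class; rewrite addrC. Qed.
Fact Lspace_add0 : left_id (Lspace_class 0) Lspace_add.
Proof. by move=> f; rewrite -[f]Lspace_reprK Lspace_addE add0r. Qed.
Fact Lspace_addN : left_inverse (Lspace_class 0) Lspace_opp Lspace_add.
Proof.
by move=> f; rewrite -[f]Lspace_reprK Lspace_oppE Lspace_addE addNr.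
Qed.

HB.instance Definition _ := gen_eqMixin V.
HB.instance Definition _ := gen_choiceMixin V.
HB.instance Definition _ := GRing.isZmodule.Build V
  Lspace_addA Lspace_addC Lspace_add0 Lspace_addN.

Let addE (f g : V) : f + g = Lspace_add f g. Proof. by []. Qed.

Fact Lspace_scaleA a b (f : V) :
  Lspace_scale a (Lspace_scale b f) = Lspace_scale (a * b) f.
Proof. by rewrite -[f]Lspace_reprK !Lspace_scaleE scalerA. Qed.
Fact Lspace_scale1 : left_id 1 Lspace_scale.
Proof. by move=> f; rewrite -[f]Lspace_reprK Lspace_scaleE scale1r. Qed.
Fact Lspace_scaleDr : right_distributive Lspace_scale +%R.
Proof.
move=> a f g; rewrite -[f]Lspace_reprK -[g]Lspace_reprK.
by rewrite !addE Lspace_addE !Lspace_scaleE Lspace_addE scalerDr.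
Qed.
Fact Lspace_scaleDl (f : V) : {morph Lspace_scale^~ f : a b / a + b}.
Proof.
move=> a b; rewrite -[f]Lspace_reprK !Lspace_scaleE scalerDl.
by rewrite addE Lspace_addE.
Qed.

HB.instance Definition _ := GRing.Zmodule_isLmodule.Build R V
  Lspace_scaleA Lspace_scale1 Lspace_scaleDr Lspace_scaleDl.

Fact Lspace_normD (f g : V) :
  Lspace_norm (f + g) <= Lspace_norm f + Lspace_norm g.
Proof.
rewrite -[f]Lspace_reprK -[g]Lspace_reprK addE Lspace_addE.
by rewrite !Lspace_normE; exact: ler_LnormD.
Qed.
Fact Lspace_normZ (a : R) (f : V) :
  Lspace_norm (a *: f) = `|a| * Lspace_norm f.
Proof.
rewrite -[f]Lspace_reprK -[_ *: _]/(Lspace_scale _ _) Lspace_scaleE.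
rewrite !Lspace_normE.
by rewrite LnormZ fineM// -finite_norm_fine.
Qed.
Fact Lspace_norm0_eq0 (f : V) : Lspace_norm f = 0 -> f = 0.
Proof.
rewrite -[f]Lspace_reprK Lspace_normE => /fine_Lnormr_eq0 f0.
exact: (@Lspace_classP _ 0).
Qed.

HB.instance Definition _ := Lmodule_isNormed.Build R V
  Lspace_normD Lspace_normZ Lspace_norm0_eq0.

End LspaceNormed.

Section Wreath.
Variable H : groupType.
Local Open Scope group_scope.
Local Open Scope fset_scope.

(* H^(Z): finitely supported functions under the pointwise product. *)
Definition lamps : Type := {fsfun int -> H with 1}.
HB.instance Definition _ := Choice.on lamps.
Implicit Types f g : lamps.
Local Coercion lamps_fun f : int -> H := fun_of_fsfun (f : {fsfun int -> H with 1}).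

Definition lamps_mul f g : lamps :=
  [fsfun k in finsupp f `|` finsupp g => f k * g k].
Definition lamps_inv f : lamps := [fsfun k in finsupp f => (f k)^-1].
Definition lamps_one : lamps := [fsfun].
Definition translate (n : int) f : lamps :=
  [fsfun k in [fset (j + n)%R | j in finsupp f] => f (k - n)%R].

Lemma lampsP f g : (forall k, f k = g k) -> f = g.
Proof. by move=> fg; apply/fsfunP. Qed.

Lemma lamps_mulE f g k : lamps_mul f g k = f k * g k.
Proof.
rewrite /lamps_fun fsfunE inE; case: ifPn => // /norP[kf kg].
by rewrite !fsfun_dflt// mulg1.
Qed.

Lemma lamps_invE f k : lamps_inv f k = (f k)^-1.
Proof.
by rewrite /lamps_fun fsfunE; case: ifPn => // kf; rewrite fsfun_dflt// invg1.
Qed.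

Lemma lamps_oneE k : lamps_one k = 1.
Proof. by rewrite /lamps_fun fsfunE. Qed.

Lemma translateE n f k : translate n f k = f (k - n)%R.
Proof.
rewrite /lamps_fun fsfunE; case: ifPn => // kf; rewrite fsfun_dflt//.
apply: contra kf => kf; apply/imfsetP; exists (k - n)%R => //.
by rewrite subrK.
Qed.

Fact lamps_mulA : associative lamps_mul.
Proof. by move=> f g h; apply: lampsP => k; rewrite !lamps_mulE mulgA. Qed.
Fact lamps_mul1 : left_id lamps_one lamps_mul.
Proof. by move=> f; apply: lampsP => k; rewrite lamps_mulE lamps_oneE mul1g. Qed.
Fact lamps_mulr1 : right_id lamps_one lamps_mul.
Proof. by move=> f; apply: lampsP => k; rewrite lamps_mulE lamps_oneE mulg1. Qed.
Fact lamps_mulV : left_inverse lamps_one lamps_inv lamps_mul.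
Proof.
by move=> f; apply: lampsP => k; rewrite lamps_mulE lamps_invE lamps_oneE mulVg.
Qed.
Fact lamps_mulrV : right_inverse lamps_one lamps_inv lamps_mul.
Proof.
by move=> f; apply: lampsP => k; rewrite lamps_mulE lamps_invE lamps_oneE mulgV.
Qed.

HB.instance Definition _ := isGroup.Build lamps
  lamps_mulA lamps_mul1 lamps_mulr1 lamps_mulV lamps_mulrV.

Lemma translateM n f g : translate n (f * g) = translate n f * translate n g.
Proof.
apply: lampsP => k; rewrite translateE [LHS]lamps_mulE [RHS]lamps_mulE.
by rewrite !translateE.
Qed.
Lemma translateD m n f : translate (m + n)%R f = translate m (translate n f).
Proof. by apply: lampsP => k; rewrite !translateE opprD addrA. Qed.
Lemma translate0 f : translate 0%R f = f.
Proof. by apply: lampsP => k; rewrite !translateE subr0. Qed.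
Lemma translate1 n : translate n 1 = 1.
Proof. by apply: lampsP => k; rewrite translateE !lamps_oneE. Qed.

(* The semidirect product of lamps by Z, (f, m)(g, n) = (f . translate m g, m + n). *)
Definition wreath : Type := (lamps * int)%type.
HB.instance Definition _ := Choice.on wreath.

Definition wreath_mul (x y : wreath) : wreath :=
  (x.1 * translate x.2 y.1, (x.2 + y.2)%R).
Definition wreath_one : wreath := (1, 0%R).
Definition wreath_inv (x : wreath) : wreath :=
  (translate (- x.2)%R x.1^-1, (- x.2)%R).

Fact wreath_mulA : associative wreath_mul.
Proof.
move=> [f m] [g n] [h k]; rewrite /wreath_mul /=.
by rewrite translateM translateD mulgA addrA.
Qed.
Fact wreath_mul1 : left_id wreath_one wreath_mul.
Proof. by move=> [f m]; rewrite /wreath_mul /= translate0 mul1g add0r. Qed.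
Fact wreath_mulr1 : right_id wreath_one wreath_mul.
Proof. by move=> [f m]; rewrite /wreath_mul /= translate1 mulg1 addr0. Qed.
Fact wreath_mulV : left_inverse wreath_one wreath_inv wreath_mul.
Proof.
move=> [f m]; rewrite /wreath_mul /= -translateM mulVg translate1.
by rewrite addNr.
Qed.
Fact wreath_mulrV : right_inverse wreath_one wreath_inv wreath_mul.
Proof.
move=> [f m]; rewrite /wreath_mul /= -translateD subrr translate0.
by rewrite mulgV.
Qed.

HB.instance Definition _ := isGroup.Build wreath
  wreath_mulA wreath_mul1 wreath_mulr1 wreath_mulV wreath_mulrV.

End Wreath.

Section WordMetric.
Variables (G : groupType) (S : seq G).
Local Open Scope group_scope.

Definition is_word (g : G) (s : seq G) : Prop :=
  all (fun x => (x \in S) || (x^-1 \in S)) s /\ g = \prod_(x <- s) x.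

Definition generates : Prop := forall g, exists s, is_word g s.

Context (genS : generates).

Fact word_exists g : exists n, `[< exists2 s, is_word g s & size s = n >].
Proof. by have [s sP] := genS g; exists (size s); apply/asboolP; exists s. Qed.

Definition word_length (g : G) : nat := ex_minn (word_exists g).

End WordMetric.

Section Compression.
Variables (R : realType) (V : normedModType R).
Variables (G : groupType) (S : seq G) (genS : generates S).

Definition word_dist (x y : G) : R := (word_length genS (x^-1 * y)%g)%:R.

Definition compression_fun (Psi : G -> V) (t : R) : \bar R :=
  ereal_inf [set `|Psi xy.1 - Psi xy.2|%:E
            | xy in [set xy : G * G | t <= word_dist xy.1 xy.2]].

(* The union with {0} only implements the convention sup {} = 0, since
   ereal_sup set0 = -oo. *)
Definition compression_exponent (Psi : G -> V) : \bar R :=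
  ereal_sup ([set 0%E] `|` [set alpha%:E | alpha in
    [set alpha : R | 0 <= alpha /\ exists2 c : R, 0 < c &
      forall t : R, 1 <= t -> ((c * t `^ alpha)%:E <= compression_fun Psi t)%E]]).

Definition affine_isometric_action (tau : G -> V -> V) : Prop :=
  [/\ forall v, tau 1%g v = v,
      forall g h v, tau (g * h)%g v = tau g (tau h v),
      forall g v w, `|tau g v - tau g w| = `|v - w| &
      forall g (r : R) v w,
        tau g (r *: v + (1 - r) *: w) = r *: tau g v + (1 - r) *: tau g w].

Definition equivariant_map (Psi : G -> V) : Prop :=
  exists tau, affine_isometric_action tau /\
    exists v, forall g, Psi g = tau g v.

Definition lipschitz_map (Psi : G -> V) : Prop :=
  exists L : R, forall x y, `|Psi x - Psi y| <= L * word_dist x y.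

Definition equivariant_exponent : \bar R :=
  ereal_sup [set compression_exponent Psi
            | Psi in [set Psi | lipschitz_map Psi /\ equivariant_map Psi]].

End Compression.

(* Restricting Lebesgue measure to [0, 1] makes values outside [0, 1]
   irrelevant, so this is L_p([0, 1]). *)
Definition Lp01 (R : realType) (p : R) (p1 : 1 <= p) : normedModType R :=
  LspaceType (p := p%:E)
    (mrestr (@lebesgue_measure R) (measurable_itv `[0, 1])) p1.

Definition alpha_sharp (R : realType) (p : R) (p1 : 1 <= p)
    (G : groupType) (S : seq G) (genS : generates S) : \bar R :=
  equivariant_exponent (Lp01 p1) genS.

(* Main.v *)
(* Write |x| for word lengths and b for the cocycle of an affine isometric action.

   Upper bound. L_p has roundness p for 1 <= p <= 2 (Enflo), so if g and x commute
   then ||b(g x)||^p or ||b(g x^-1)||^p is at most ||b(g)||^p + ||b(x)||^p.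
   Starting from h in the lamp at 0 and repeatedly appending a translate by 2^k,
   or its inverse, one gets for n = 2^k an element x with lamps h or h^-1 on [0, n[
   and ||b(x)|| <= n^(1/p) ||b(h)|| + D n, while |x| >= C n |h|. If b has exponent
   alpha on H wr Z, taking n^(1-1/p) of the order of ||b(h)|| shows that b has
   exponent alpha (1 - 1/p) / (1 - alpha) on H.

   Lower bound. For x = (f, m), let S be the sum of the |f(k)| and r the largest of
   |m| and the |k| with f(k) <> 1, so that |x| is of the order of S + r. The l_p-sum
   over Z of a cocycle of H of exponent beta has norm at least
   c r^(- max(0, beta - 1/p)) S^beta, and a coboundary over the configurations of
   lamps on half-lines gives, for every delta < 1, a cocycle of norm at least
   c r^delta. Interpolating between the two yields the exponent.
   These actions live on L_p([0, 1]) because cutting ]0, 1] into the dyadic intervals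
   ]2^-(n+1), 2^-n] identifies it with the l_p-sum of countably many copies of
   itself. *)
From HB Require Import structures.
Require Import Defs.
From mathcomp Require Import all_boot all_order all_algebra.
From mathcomp Require Import finmap.
From mathcomp Require Import all_classical all_reals all_analysis.
From mathcomp Require Import measurable_realfun hoelder.
From mathcomp Require Import ring lra zify.
Import Order.TTheory GRing.Theory Num.Theory.
Import numFieldNormedType.Exports.
Set Implicit Arguments.
Unset Strict Implicit.
Unset Printing Implicit Defensive.
Local Open Scope classical_set_scope.
Local Open Scope ring_scope.

(** * The space L_p([0, 1]) *)

(** An equivariant map enters only through the displacement n(g) = ||g v - v|| of its base point,
    and the Lipschitz condition is then automatic; the exponent becomes the supremum of the alpha
    with n(g) >= c |g|^alpha for g of positive length. The group side uses three properties of L_p: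
    roundness p, the splitting into an l_p-sum of copies of itself, and a unit vector.

    The l_p-sum of lamp cocycles sees neither the shift nor the positions of the lamps, and
    spreading a total S over about r positions costs a power of r with exponent max(0, beta - 1/p).
    The second cocycle bounds r, hence this loss. As delta tends to 1, the exponents reached
    approach beta if beta <= 1/p and beta / (beta + 1 - 1/p) if beta >= 1/p; the two agree at beta =
    1/p, which explains the minimum.

    The doubling argument needs 2^(1/p) < 2, that is p > 1, since otherwise the shifts are not
    absorbed in a linear term. For p = 1 the minimum is the exponent of H itself and restriction to
    one lamp suffices. *)

Section Lp01.
Context (R : realType) (p : R) (p1 : 1 <= p).
Local Notation lam := (@lebesgue_measure R).
Local Notation mu := (mrestr (@lebesgue_measure R) (measurable_itv `[0, 1])).
Local Notation V := (Lp01 p1).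
Local Notation T := (measurableTypeR R).

Let p0 : 0 < p. Proof. exact: lt_le_trans p1. Qed.
Implicit Types f g : T -> R.
Let p1e : (1 <= p%:E)%E := p1.

(** [Lspace_repr] commutes with the operations of [V] only almost everywhere, so vectors are handled
    through arbitrary measurable representatives, and [represents_inj] brings the result back to an
    equality in [V]. *)
Definition represents (f : T -> R) (v : V) : Prop :=
  measurable_fun setT f /\ ((f : T -> R) = (Lspace_repr v : T -> R) %[ae mu]).

Lemma represents_repr v : represents (Lspace_repr v) v.
Proof.
split; last exact: ae_eq_refl.
exact: (measurable_funPT (Lspace_repr v)).
Qed.

Lemma represents_norm f v : represents f v ->
  ((`|v| `^ p)%:E = \int[mu]_x (`|f x| `^ p)%:E)%E.
Proof.
move=> [mf fv].
rewrite -[ `|v| ]/(Lspace_norm v) /Lspace_norm.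
rewrite -(ae_eq_Lnorm p1e mf _ fv); last exact: (measurable_funPT (Lspace_repr v)).
rewrite -poweR_EFin fineK ?powR_Lnorm ?gt_eqF//.
rewrite ge0_fin_numE ?Lnorm_ge0// (ae_eq_Lnorm p1e mf _ fv).
  exact: Lfunction_finite.
exact: (measurable_funPT (Lspace_repr v)).
Qed.

Lemma represents_exists f : measurable_fun setT f ->
  (\int[mu]_x (`|f x| `^ p)%:E < +oo)%E -> exists v, represents f v.
Proof.
move=> mf fp.
have fL : f \in Lfun mu p%:E.
  rewrite inE; apply/andP; split; rewrite inE /=; first exact: mf.
  rewrite /finite_norm unlock /Lnorm/= poweR_lty//.
exists (Lspace_class (@Lfun_Sub _ _ _ mu _ p1e f fL)); split => //.
exact/ae_eq_sym/repr_class.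
Qed.

Lemma represents_add f g v w :
  represents f v -> represents g w -> represents (fun x => f x + g x) (v + w).
Proof.
move=> [mf fv] [mg gw]; split; first exact: measurable_funD.
apply: ae_eq_trans; last exact/ae_eq_sym/repr_class.
by apply: filterS2 fv gw => x fv gw xT; rewrite fv// gw.
Qed.

Lemma represents_scale (a : R) f v :
  represents f v -> represents (fun x => a * f x) (a *: v).
Proof.
move=> [mf fv]; split; first exact: measurable_funM.
apply: ae_eq_trans; last exact/ae_eq_sym/repr_class.
by apply: filterS fv => x fv xT; rewrite fv.
Qed.

Lemma represents_inj f v w : represents f v -> represents f w -> v = w.
Proof.
move=> [_ fv] [_ fw]; apply: LspaceP; apply: ae_eq_trans fw.
exact: ae_eq_sym.
Qed.

Lemma represents_ae f g v : represents f v -> measurable_fun setT g ->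
  (g = f %[ae mu]) -> represents g v.
Proof. by move=> [mf fv] mg gf; split => //; exact: ae_eq_trans fv. Qed.


Definition affine (c d : R) (x : T) : T := c * x + d.

Lemma measurable_affine c d : measurable_fun setT (affine c d).
Proof. by apply: measurable_funD => //; exact: measurable_funM. Qed.

(** The pushforward of [lam] scaled by [c] agrees with [lam] on half-open intervals; uniqueness of
    Lebesgue measure does the rest. *)
Lemma lebesgue_measure_affine (c d : R) (A : set T) : 0 < c -> measurable A ->
  (c%:E * lam (affine c d @^-1` A) = lam A)%E.
Proof.
move=> c0 mA.
pose m := mscale (NngNum (ltW c0)) (pushforward lam (affine c d)).
rewrite -[LHS]/(m (measurable_affine c d) A); apply/esym/lebesgue_measure_unique => // _ [[a b]] _ <-.
rewrite /= /m /mscale/= /pushforward.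
have -> : affine c d @^-1` `]a, b]%classic = `](a - d) / c, (b - d) / c]%classic.
  apply/seteqP; split => x /=; rewrite !in_itv/= /affine.
    by rewrite ltr_pdivrMr// ler_pdivlMr// ltrBlDr lerBrDr (mulrC x).
  by rewrite ltr_pdivrMr// ler_pdivlMr// ltrBlDr lerBrDr (mulrC x).
rewrite !lebesgue_measure_itv/= !lte_fin ltr_pM2r ?invr_gt0// ltrD2r.
case: ifPn => // _; last by rewrite mule0.
by rewrite -!EFinD -EFinM; congr EFin; field; rewrite gt_eqF.
Qed.

Lemma ge0_integral_affine (c d : R) (D : set T) (f : T -> \bar R) : 0 < c ->
  measurable D -> measurable_fun setT f -> (forall x, 0 <= f x)%E ->
  (c%:E * \int[lam]_(x in affine c d @^-1` D) f (affine c d x)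
  = \int[lam]_(x in D) f x)%E.
Proof.
move=> c0 mD mf f0.
have mphi := measurable_affine c d.
rewrite -[X in (_ * X)%E](@ge0_integral_pushforward _ _ _ _ _ _ mphi)//.
- rewrite -(ge0_integral_mscale _ _ (NngNum (ltW c0)))//; last exact: measurable_funTS.
  apply: eq_measure_integral => A mA _.
  by rewrite /= /mscale/= /pushforward lebesgue_measure_affine.
- exact: measurable_funTS.
Qed.

Let mu_setC : mu (~` (`]0, 1]%classic : set R)) = 0%E.
Proof.
rewrite /= /mrestr; apply/eqP; rewrite eq_le measure_ge0 andbT.
rewrite -(@lebesgue_measure_set1 R 0); apply: le_measure; rewrite ?inE.
- by apply: measurableI => //; exact: measurableC.
- exact: measurable_set1.
- move=> x /=; rewrite !in_itv/= => -[/negP + /andP[x0 x1]].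
  by rewrite x1 andbT -leNgt => x0'; apply/eqP; rewrite eq_le x0 x0'.
Qed.

(** The null point 0 is discarded because the intervals [J_ n] cover only ]0, 1]. *)
Lemma ge0_integral_mu (f : T -> \bar R) :
  measurable_fun setT f -> (forall x, 0 <= f x)%E ->
  (\int[mu]_x f x = \int[lam]_(x in `]0%R, 1%R]) f x)%E.
Proof.
move=> mf f0; rewrite (@ge0_negligible_integral _ _ _ _ _ (~` (`]0, 1]%classic : set R) : set T))//.
- rewrite setTD setCK; apply: eq_measure_integral => A mA A01.
  by rewrite /= /mrestr setIidl// => x /A01; apply: subset_itv_oc_cc.
- exact: measurableC.
Qed.

(** The dyadic interval [J_ n] has length equal to its left endpoint [c_ n], so the increasing
    affine bijection [phi_ n] from ]0, 1] onto it uses [c_ n] twice. *)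
Local Notation c_ n := ((2 ^- n.+1) : R).
Local Notation J_ n := (`]c_ n, 2 ^- n]%classic : set R).
Local Notation phi_ n := (affine (c_ n) (c_ n)).

Let c_gt0 n : 0 < c_ n. Proof. by rewrite invr_gt0 exprn_gt0. Qed.
Let c_double n : 2 ^- n = c_ n + c_ n.
Proof. by rewrite exprS invfM -mulrDl -[in RHS]div1r -splitr mul1r. Qed.
Let c_le1 n : 2 ^- n <= 1 :> R.
Proof. by rewrite invf_le1 ?exprn_gt0// exprn_ege1// ler1n. Qed.

Lemma preimage_phi n : phi_ n @^-1` J_ n = (`]0, 1]%classic : set R).
Proof.
apply/seteqP; split => x /=; rewrite !in_itv/= /affine (c_double n).
  by rewrite ltrDr lerD2r ger_pMr// pmulr_rgt0.
by rewrite ltrDr lerD2r ger_pMr// pmulr_rgt0.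
Qed.

Lemma bigcup_J : \bigcup_n J_ n = (`]0, 1]%classic : set R).
Proof.
apply/seteqP; split => x /=.
  move=> [n _] /=; rewrite !in_itv/= => /andP[nx xn].
  by rewrite (lt_trans _ nx)//= (le_trans xn).
rewrite in_itv/= => /andP[x0 x1].
have ex : exists n, 2 ^- n < x.
  exists (Num.truncn x^-1).+1; rewrite invf_plt ?posrE ?exprn_gt0//.
  apply: lt_trans (truncnS_gt _) _.
  by rewrite -natrX ltr_nat ltn_expl.
case: (ex_minnP ex) => -[|n] nx nmin.
  by move: nx; rewrite expr0 invr1 ltNge x1.
exists n => //=; rewrite in_itv/= nx leNgt; apply/negP => /nmin.
by rewrite ltnn.
Qed.

Lemma trivIset_J : trivIset setT (fun n => J_ n).
Proof.
apply/trivIsetP => i j _ _; wlog ij : i j / (i < j)%N.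
  move=> h; rewrite neq_ltn => /orP[ij|ji]; first by rewrite h// ltn_eqF.
  by rewrite setIC h// ltn_eqF.
move=> _; apply/seteqP; split => x //= [] /=; rewrite !in_itv/=.
move=> /andP[ix _] /andP[_ xj]; have := lt_le_trans ix xj.
by rewrite ltf_pV2 ?posrE ?exprn_gt0// ltr_eXn2l ?ltr1n// ltnS leqNgt ij.
Qed.

Lemma integral_phi n (f : T -> \bar R) :
  measurable_fun setT f -> (forall x, 0 <= f x)%E ->
  ((c_ n)%:E * \int[mu]_x f (phi_ n x) = \int[lam]_(x in J_ n) f x)%E.
Proof.
move=> mf f0; rewrite ge0_integral_mu//; last first.
  exact: measurableT_comp mf (measurable_affine _ _).
by rewrite -(preimage_phi n) ge0_integral_affine.
Qed.

(** Taking preimages under [phi_ n] divides Lebesgue measure by [c_ n], so null sets pull back to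
    null sets; the restriction in [mu] is respected because [phi_ n] maps [0, 1] into itself. *)
Lemma ae_phi n (f g : T -> R) :
  (f = g %[ae mu]) -> (f \o phi_ n = g \o phi_ n %[ae mu]).
Proof.
move=> [N [mN N0 fgN]]; exists (phi_ n @^-1` N); split.
- by rewrite -[X in measurable X]setTI; exact: measurable_affine.
- apply/eqP; rewrite eq_le measure_ge0 andbT /= /mrestr.
  have c0 : (0 < (c_ n)%:E)%E by rewrite lte_fin.
  rewrite -(@lee_pmul2l _ (c_ n)%:E)// mule0.
  rewrite (@le_trans _ _ ((c_ n)%:E * lam (phi_ n @^-1` (N `&` `[0%R, 1%R])))%E)//.
    rewrite lee_pmul2l//; apply: (le_measure lam); rewrite ?inE.
    + apply: measurableI => //.
      by rewrite -[X in measurable X]setTI; exact: measurable_affine.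
    + rewrite -[X in measurable X]setTI; apply: measurable_affine => //.
      exact: measurableI.
    + move=> x [] Nx; rewrite /= !in_itv/= /affine => /andP[x0 x1]; split=> //.
      rewrite addr_ge0 ?mulr_ge0 ?(ltW (c_gt0 n))//=.
      apply: le_trans (c_le1 n); rewrite (c_double n) lerD2r.
      by rewrite ger_pMr.
  rewrite lebesgue_measure_affine//; last exact: measurableI.
  by rewrite -[leLHS]/(mu N) N0.
- by move=> x /= fgx; apply: fgN => /= fgx'; apply: fgx => _; exact: fgx'.
Qed.

(** The part of [v] living on [J_ n], stretched to the unit interval; the factor, the p-th root of
    [c_ n], makes the stretching isometric. The vector chosen by [get] is unique by
    [represents_inj]. *)
Definition piece (n : nat) (v : V) : V :=
  get (represents (fun x => c_ n `^ p^-1 * (Lspace_repr v : T -> R) (phi_ n x))).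

Let powK (a x : R) : 0 <= a -> `|a `^ p^-1 * x| `^ p = a * `|x| `^ p.
Proof.
move=> a0; rewrite normrM (ger0_norm (powR_ge0 _ _)) powRM ?powR_ge0//.
by rewrite -powRrM mulVf ?gt_eqF// powRr1.
Qed.

Let measurable_normp f : measurable_fun setT f ->
  measurable_fun setT (fun x => (`|f x| `^ p)%:E).
Proof.
move=> mf; apply/measurable_EFinP.
apply: (measurableT_comp (measurable_powR _)) => //.
exact: measurableT_comp.
Qed.

Let measurable_piece (k a b : R) f : measurable_fun setT f ->
  measurable_fun setT (fun x => k * f (affine a b x)).
Proof.
move=> mf; apply: measurable_funM => //.
exact: measurableT_comp mf (measurable_affine _ _).
Qed.

Lemma integral_piece n f : measurable_fun setT f ->
  (\int[mu]_x (`|c_ n `^ p^-1 * f (phi_ n x)| `^ p)%:E =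
   \int[lam]_(x in J_ n) (`|f x| `^ p)%:E)%E.
Proof.
move=> mf; under eq_integral do rewrite powK ?(ltW (c_gt0 n))// EFinM.
rewrite ge0_integralZl_EFin ?(ltW (c_gt0 n))//; last first.
  exact: measurable_normp (measurableT_comp mf (measurable_affine _ _)).
by rewrite (integral_phi n (measurable_normp mf)).
Qed.

Lemma represents_piece n f v : represents f v ->
  represents (fun x => c_ n `^ p^-1 * f (phi_ n x)) (piece n v).
Proof.
move=> fv; have [mr _] := represents_repr v.
have : represents (fun x => c_ n `^ p^-1 * (Lspace_repr v : T -> R) (phi_ n x))
    (piece n v).
  apply: getPex; apply: represents_exists.
    exact: measurable_piece.
  rewrite integral_piece//.
  have := represents_norm (represents_repr v); rewrite ge0_integral_mu; last 2 first.
    exact: measurable_normp.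
    by move=> x; rewrite lee_fin powR_ge0.
  move=> E; apply: (@le_lt_trans _ _ ((`|v| `^ p)%:E)); last exact: ltry.
  rewrite E; apply: ge0_subset_integral => //.
  - exact: measurable_funTS (measurable_normp mr).
  - by rewrite -bigcup_J; exact: (@bigcup_sup _ _ n setT (fun n => J_ n)).
move=> /represents_ae; apply.
  exact: measurable_piece fv.1.
apply: filterS (ae_phi n fv.2) => x /= E _; by rewrite E.
Qed.

Lemma pieceD n v w : piece n (v + w) = piece n v + piece n w.
Proof.
apply: represents_inj.
  apply: represents_piece.
  exact: represents_add (represents_repr v) (represents_repr w).
apply: represents_ae (represents_add (represents_piece n (represents_repr v))
  (represents_piece n (represents_repr w))) _ _.
  apply: (@measurable_piece _ _ _ (fun x => Lspace_repr v x + Lspace_repr w x)).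
  by apply: measurable_funD; [exact: (represents_repr v).1|exact: (represents_repr w).1].
by apply: aeW => x _ /=; rewrite mulrDr.
Qed.

Lemma pieceZ n (a : R) v : piece n (a *: v) = a *: piece n v.
Proof.
apply: represents_inj.
  by apply: represents_piece; exact: represents_scale (represents_repr v).
apply: represents_ae (represents_scale a (represents_piece n (represents_repr v))) _ _.
  apply: (@measurable_piece _ _ _ (fun x => a * Lspace_repr v x)).
  by apply: measurable_funM => //; exact: (represents_repr v).1.
by apply: aeW => x _ /=; rewrite mulrCA.
Qed.

Lemma integral_pieces (f : T -> R) : measurable_fun setT f ->
  (\int[mu]_x (`|f x| `^ p)%:E =
   \esum_(n in [set: nat]) \int[lam]_(x in J_ n) (`|f x| `^ p)%:E)%E.
Proof.
move=> mf; rewrite ge0_integral_mu; last 2 first.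
- exact: measurable_normp.
- by move=> x; rewrite lee_fin powR_ge0.
rewrite -bigcup_J ge0_integral_bigcup//.
- rewrite nneseries_esumT// => n; apply: integral_ge0 => x _.
  by rewrite lee_fin powR_ge0.
- exact: measurable_funTS (measurable_normp mf).
- exact: trivIset_J.
Qed.

Lemma piece_norm v :
  ((`|v| `^ p)%:E = \esum_(n in [set: nat]) (`|piece n v| `^ p)%:E)%E.
Proof.
have [mv _] := represents_repr v.
rewrite (represents_norm (represents_repr v)) integral_pieces//.
apply: eq_esum => n _.
by rewrite (represents_norm (represents_piece n (represents_repr v))) integral_piece.
Qed.

Lemma piece_surj (u : nat -> V) :
  (\esum_(n in [set: nat]) (`|u n| `^ p)%:E < +oo)%E ->
  exists v, forall n, piece n v = u n.
Proof.
move=> uy.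
(* The affine map here is the inverse of [phi_ n]; [f] glues the functions [g n] along the disjoint
   intervals [J_ n]. *)
pose g n : T -> R := fun x =>
  (c_ n `^ p^-1)^-1 * (Lspace_repr (u n) : T -> R) (affine (c_ n)^-1 (-1) x).
pose f (x : T) : R :=
  if pselect (exists n, J_ n x) is left ex then g (projT1 (cid ex)) x else 0.
have fJ n x : J_ n x -> f x = g n x.
  move=> Jx; rewrite /f; case: pselect => [ex|[]]; last by exists n.
  case: (cid ex) => m /= Jmx; congr g; apply/eqP/negPn/negP => mn.
  by have /trivIsetP/(_ m n I I mn)/seteqP[+ _] := trivIset_J; move=> /(_ x); apply.
have mg n : measurable_fun setT (g n).
  apply: measurable_piece; exact: (represents_repr _).1.
have mf : measurable_fun setT f.
  rewrite -(setUv (\bigcup_n J_ n)); apply/measurable_funU.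
  - exact: bigcup_measurable.
  - by apply: measurableC; exact: bigcup_measurable.
  split.
    apply/measurable_fun_bigcup => // n.
    apply: (@eq_measurable_fun _ _ _ _ _ (g n)).
      by move=> x; rewrite inE => /fJ ->.
    exact: measurable_funTS.
  apply: (@eq_measurable_fun _ _ _ _ _ (fun=> 0 : R)); last exact: measurable_cst.
  move=> x; rewrite inE => Jx; rewrite /f; case: pselect => // -[n Jnx].
  by exfalso; apply: Jx; exists n.
have fphi n x : (`]0, 1]%classic : set R) x ->
    c_ n `^ p^-1 * f (phi_ n x) = (Lspace_repr (u n) : T -> R) x.
  rewrite -(preimage_phi n) => Jx; rewrite (fJ n)// /g mulrA divff ?mul1r; last first.
    by rewrite gt_eqF// powR_gt0.
  congr (Lspace_repr (u n) : T -> R); rewrite /affine.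
  by rewrite mulrDr mulVf ?gt_eqF// mulrA mulVf ?gt_eqF// mul1r addrK.
have uE n : represents (fun x => c_ n `^ p^-1 * f (phi_ n x)) (u n).
  apply: represents_ae (represents_repr _) _ _.
    exact: measurable_piece.
  exists (~` (`]0, 1]%classic : set R)); split.
  - exact: measurableC.
  - exact: mu_setC.
  - by move=> x /= nfx x01; apply: nfx => _; exact: fphi.
have [v fv] : exists v, represents f v.
  apply: represents_exists => //; rewrite integral_pieces//.
  apply: le_lt_trans uy; apply: le_esum => n _.
  by rewrite -integral_piece// -(represents_norm (uE n)).
exists v => n; apply: represents_inj (uE n); exact: represents_piece.
Qed.

End Lp01.

(** * Roundness *)

Section RealRoundness.
Context (R : realType).
Implicit Types (p s x y u w : R).

Lemma powR_convex p t x y : 1 <= p -> 0 <= t <= 1 -> 0 <= x -> 0 <= y ->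
  (t * x + (1 - t) * y) `^ p <= t * x `^ p + (1 - t) * y `^ p.
Proof.
move=> p1 /andP[t0 t1] x0 y0.
have := @convex_powR R p p1 (Itv01 t0 t1) x y.
by rewrite !convRE /=; apply; rewrite inE/= in_itv/= ?x0 ?y0.
Qed.

(** Convexity with the denominator [w - u] cleared: the degenerate interval is allowed and the
    conclusion is ready for linear arithmetic. *)
Lemma powR_chord p u x w : 1 <= p -> 0 <= u -> u <= x <= w ->
  (w - u) * x `^ p <= (w - x) * u `^ p + (x - u) * w `^ p.
Proof.
move=> p1 u0 /andP[ux xw].
have [uw|uw] := leP w u.
  have -> : x = u by lra.
  have -> : w = u by lra.
  lra.
have d0 : 0 < w - u by rewrite subr_gt0.
have t1 : 0 <= (w - x) / (w - u) <= 1.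
  apply/andP; split; first by apply: divr_ge0; lra.
  by rewrite ler_pdivrMr// mul1r; lra.
have := powR_convex p1 t1 u0 (le_trans u0 (ltW uw)).
have -> : (w - x) / (w - u) * u + (1 - (w - x) / (w - u)) * w = x.
  by field; lra.
rewrite -(ler_pM2l d0) => /le_trans; apply.
by rewrite le_eqVlt; apply/orP; left; apply/eqP; field; lra.
Qed.

(** Concavity follows from the convexity of the power [s^-1], applied to the s-th powers of [u] and
    [w]. *)
Lemma powR_concave_chord s u x w : 0 < s <= 1 -> 0 <= u -> u <= x <= w ->
  (w - x) * u `^ s + (x - u) * w `^ s <= (w - u) * x `^ s.
Proof.
move=> /andP[s0 s1] u0 /andP[ux xw].
have x0 : 0 <= x by exact: le_trans ux.
have w0 : 0 <= w by exact: le_trans xw.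
have [uw|uw] := leP w u.
  have -> : x = u by lra.
  have -> : w = u by lra.
  lra.
have d0 : 0 < w - u by rewrite subr_gt0.
have t1 : 0 <= (w - x) / (w - u) <= 1.
  apply/andP; split; first by apply: divr_ge0; lra.
  by rewrite ler_pdivrMr// mul1r; lra.
have si1 : 1 <= s^-1 by rewrite invf_ge1.
have := powR_convex si1 t1 (powR_ge0 u s) (powR_ge0 w s).
rewrite -!powRrM mulfV ?gt_eqF// !powRr1//.
have -> : (w - x) / (w - u) * u + (1 - (w - x) / (w - u)) * w = x.
  by field; lra.
set z := (X in X `^ s^-1 <= _) => zx.
have z0 : 0 <= z.
  by rewrite /z; case/andP: t1 => *; rewrite addr_ge0// mulr_ge0 ?powR_ge0 ?subr_ge0.
have : z <= x `^ s.
  have -> : z = (z `^ s^-1) `^ s by rewrite -powRrM mulVf ?gt_eqF// powRr1.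
  by rewrite ge0_ler_powR ?(ltW s0) ?nnegrE ?powR_ge0.
rewrite -(ler_pM2l d0); apply: le_trans.
by rewrite le_eqVlt; apply/orP; left; apply/eqP; rewrite /z; field; lra.
Qed.

(** The points u + v and v + w lie between v and u + v + w and have the same sum as these endpoints,
    so two chord inequalities add up to the claim. *)
Lemma powR_supermodular p u v w : 1 <= p -> 0 <= u -> 0 <= v -> 0 <= w ->
  (u + v) `^ p + (v + w) `^ p <= (u + v + w) `^ p + v `^ p.
Proof.
move=> p1 u0 v0 w0; have [/eqP uw|uw] := eqVneq (u + w) 0.
  have -> : u = 0 by apply/eqP; move: uw; rewrite paddr_eq0// => /andP[].
  have -> : w = 0 by apply/eqP; move: uw; rewrite paddr_eq0// => /andP[].
  by rewrite add0r !addr0.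
have d0 : 0 < u + w by rewrite lt_neqAle eq_sym uw addr_ge0.
have h1 : v <= u + v <= u + v + w by apply/andP; split; lra.
have h2 : v <= v + w <= u + v + w by apply/andP; split; lra.
have c1 := powR_chord p1 v0 h1; have c2 := powR_chord p1 v0 h2.
rewrite -(ler_pM2l d0); lra.
Qed.

(* The chord of [y `^ (p / 2)] over [v^2, (u + v + w)^2] has slope at most
   that of every chord through the origin. *)
Lemma powR_nested p u v w : 1 <= p <= 2 -> 0 <= u -> 0 <= v -> 0 <= w ->
  (u + v + w) `^ p + v `^ p <= (u + v) `^ p + (v + w) `^ p + u `^ p + w `^ p.
Proof.
move=> /andP[p1 p2] u0 v0 w0.
have s01 : 0 < p / 2 <= 1 by apply/andP; split; lra.
have sq x : 0 <= x -> x `^ p = (x ^+ 2) `^ (p / 2).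
  by move=> x0; rewrite -powR_mulrn// -powRrM mulrC divfK.
rewrite !sq ?addr_ge0//.
have s0 : p / 2 != 0 by case/andP: s01 => s0 _; rewrite gt_eqF.
move: (p / 2) s01 s0 {sq} => s s01 s0.
have [/eqP uw|uw] := eqVneq (u + w) 0.
  have -> : u = 0 by apply/eqP; move: uw; rewrite paddr_eq0// => /andP[].
  have -> : w = 0 by apply/eqP; move: uw; rewrite paddr_eq0// => /andP[].
  by rewrite add0r !addr0 expr0n/= powR0// !addr0.
have d0 : 0 < u + w by rewrite lt_neqAle eq_sym uw addr_ge0.
set L1 := (u + v + w) ^+ 2; set L2 := v ^+ 2.
have L20 : 0 <= L2 by exact: sqr_ge0.
have D0 : 0 < L1 - L2 by rewrite /L1 /L2; nra.
have L10 : 0 < L1 by lra.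
have c1 := @powR_concave_chord s L2 ((u + v) ^+ 2) L1 s01 L20.
have c2 := @powR_concave_chord s L2 ((v + w) ^+ 2) L1 s01 L20.
have c3 := @powR_concave_chord s 0 (u ^+ 2) L1 s01 (lexx _).
have c4 := @powR_concave_chord s 0 (w ^+ 2) L1 s01 (lexx _).
have c5 := @powR_concave_chord s 0 L2 L1 s01 (lexx _).
have {}c1 : (L1 - (u + v) ^+ 2) * L2 `^ s + ((u + v) ^+ 2 - L2) * L1 `^ s <= (L1 - L2) * ((u + v) ^+ 2) `^ s.
  by apply: c1; rewrite /L1 /L2; apply/andP; split; nra.
have {}c2 : (L1 - (v + w) ^+ 2) * L2 `^ s + ((v + w) ^+ 2 - L2) * L1 `^ s <= (L1 - L2) * ((v + w) ^+ 2) `^ s.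
  by apply: c2; rewrite /L1 /L2; apply/andP; split; nra.
have {}c3 : u ^+ 2 * L1 `^ s <= L1 * (u ^+ 2) `^ s.
  have := c3; rewrite powR0// mulr0 add0r !subr0; apply.
  by rewrite /L1; apply/andP; split; nra.
have {}c4 : w ^+ 2 * L1 `^ s <= L1 * (w ^+ 2) `^ s.
  have := c4; rewrite powR0// mulr0 add0r !subr0; apply.
  by rewrite /L1; apply/andP; split; nra.
have {}c5 : L2 * L1 `^ s <= L1 * L2 `^ s.
  have := c5; rewrite powR0// mulr0 add0r !subr0; apply.
  by apply/andP; split; lra.
have E : (u + v) ^+ 2 + (v + w) ^+ 2 + u ^+ 2 + w ^+ 2 >= L1 + L2.
  by rewrite /L1 /L2; have := sqr_ge0 (u - w); nra.
have P1 := powR_ge0 L1 s; have P2 := powR_ge0 L2 s.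
have mono : L2 `^ s <= L1 `^ s.
  by case/andP: s01 => *; rewrite ge0_ler_powR ?nnegrE//; lra.
have U0 : 0 <= u ^+ 2 by exact: sqr_ge0.
have W0 : 0 <= w ^+ 2 by exact: sqr_ge0.
move: (((u + v) ^+ 2) `^ s) (((v + w) ^+ 2) `^ s) ((u ^+ 2) `^ s) ((w ^+ 2) `^ s) c1 c2 c3 c4 => r1 r2 r3 r4.
move: ((u + v) ^+ 2) ((v + w) ^+ 2) (u ^+ 2) (w ^+ 2) (L1 `^ s) (L2 `^ s) E P1 P2 c5 mono U0 W0.
move: L1 L2 L20 D0 L10 => L1 L2 L20 D0 L10 R1 R2 R3 R4 A B E A0 B0 c5 mono U0 W0 c1 c2 c3 c4.
have {}c3 : R3 * (A - B) <= (L1 - L2) * r3.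
  rewrite -(ler_pM2l L10); apply: (@le_trans _ _ ((L1 - L2) * (R3 * A))).
    rewrite -subr_ge0 (_ : _ - _ = R3 * (L1 * B - L2 * A)); last by ring.
    by rewrite mulr_ge0// subr_ge0.
  by rewrite (mulrCA L1) ler_pM2l.
have {}c4 : R4 * (A - B) <= (L1 - L2) * r4.
  rewrite -(ler_pM2l L10); apply: (@le_trans _ _ ((L1 - L2) * (R4 * A))).
    rewrite -subr_ge0 (_ : _ - _ = R4 * (L1 * B - L2 * A)); last by ring.
    by rewrite mulr_ge0// subr_ge0.
  by rewrite (mulrCA L1) ler_pM2l.
rewrite -(ler_pM2l D0).
have : (R1 + R2 + R3 + R4 - L1 - L2) * (A - B) >= 0.
  by rewrite mulr_ge0//; lra.
lra.
Qed.

(** By symmetry [a] is the least point, with a <= c and b <= d. The diagonals [a, c] and [b, d] are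
    then disjoint, interlaced or nested, and the three cases follow from monotonicity,
    [powR_supermodular] and [powR_nested]; only the nested case needs p <= 2. *)
Lemma roundness_real p (a b c d : R) : 1 <= p <= 2 ->
  `|a - c| `^ p + `|b - d| `^ p <=
  `|a - b| `^ p + `|b - c| `^ p + `|c - d| `^ p + `|d - a| `^ p.
Proof.
move=> p12; have /andP[p1 p2] := p12; have p0 : 0 <= p by lra.
have D x y : `|x - y| `^ p = `|y - x| `^ p by rewrite distrC.
wlog ac : a c / a <= c.
  move=> h; have [/h//|/ltW/h] := leP a c.
  by rewrite (D c a) (D c b) (D b a) (D a d) (D d c); lra.
wlog bd : b d / b <= d.
  move=> h; have [/h//|/ltW/h] := leP b d.
  by rewrite (D d b) (D a d) (D d c) (D c b) (D b a); lra.
wlog ab : a b c d ac bd / a <= b.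
  move=> h; have [ab|/ltW ba] := leP a b; first exact: h.
  by have := h b a d c bd ac ba; rewrite (D b a) (D a d) (D d c) (D c b); lra.
rewrite (distrC a c) (distrC b d) (distrC a b).
have mono x y : 0 <= x -> x <= y -> x `^ p <= y `^ p.
  by move=> x0 xy; rewrite ge0_ler_powR ?nnegrE//; lra.
have P x : 0 <= x `^ p by exact: powR_ge0.
rewrite (ger0_norm (_ : 0 <= c - a)) ?(ger0_norm (_ : 0 <= d - b)) ?(ger0_norm (_ : 0 <= b - a)) ?(ger0_norm (_ : 0 <= d - a)) ; try lra.
have [cb|bc] := leP c b.
  rewrite (distrC c d) (ger0_norm (_ : 0 <= b - c)) ?(ger0_norm (_ : 0 <= d - c)); try lra.
  have := mono (c - a) (b - a); have := mono (d - b) (d - a).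
  have := P (b - c); have := P (d - c).
  move=> ? ? h1 h2.
  have {}h1 : (d - b) `^ p <= (d - a) `^ p by apply: h1; lra.
  have {}h2 : (c - a) `^ p <= (b - a) `^ p by apply: h2; lra.
  lra.
rewrite (distrC b c) (ger0_norm (_ : 0 <= c - b)); last lra.
have [cd|dc] := leP c d.
  rewrite (distrC c d) (ger0_norm (_ : 0 <= d - c)); last lra.
  have := @powR_supermodular p (b - a) (c - b) (d - c) p1.
  have -> : b - a + (c - b) = c - a by ring.
  have -> : c - b + (d - c) = d - b by ring.
  have -> : c - a + (d - c) = d - a by ring.
  have := P (b - a); have := P (d - c); move=> ? ? h.
  have {}h : (c - a) `^ p + (d - b) `^ p <= (d - a) `^ p + (c - b) `^ p by apply: h; lra.
  lra.
rewrite (ger0_norm (_ : 0 <= c - d)); last lra.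
have := @powR_nested p (b - a) (d - b) (c - d) p12.
have -> : b - a + (d - b) = d - a by ring.
have -> : d - b + (c - d) = c - b by ring.
have -> : d - a + (c - d) = c - a by ring.
move=> h.
have {}h : (c - a) `^ p + (d - b) `^ p <= (d - a) `^ p + (c - b) `^ p + (b - a) `^ p + (c - d) `^ p by apply: h; lra.
lra.
Qed.

End RealRoundness.

Definition has_roundness (R : realType) (V : normedModType R) (p : R) : Prop :=
  forall a b c d : V,
  `|a - c| `^ p + `|b - d| `^ p <=
  `|a - b| `^ p + `|b - c| `^ p + `|c - d| `^ p + `|d - a| `^ p.

Section Lp01Geometry.
Context (R : realType) (p : R) (p1 : 1 <= p).
Local Notation mu := (mrestr (@lebesgue_measure R) (measurable_itv `[0, 1])).
Local Notation V := (Lp01 p1).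
Local Notation T := (measurableTypeR R).

Let measurable_normp (f : T -> R) : measurable_fun setT f ->
  measurable_fun setT (fun x => (`|f x| `^ p)%:E).
Proof.
move=> mf; apply/measurable_EFinP.
apply: (measurableT_comp (measurable_powR _)) => //.
exact: measurableT_comp.
Qed.

Lemma represents_sub (f g : T -> R) (v w : V) :
  represents f v -> represents g w -> represents (fun x => f x - g x) (v - w).
Proof.
move=> fv gw; rewrite -scaleN1r.
apply: represents_ae (represents_add fv (represents_scale (-1) gw)) _ _.
  by apply: measurable_funB; [exact: fv.1|exact: gw.1].
by apply: aeW => x _; rewrite mulN1r.
Qed.

Local Notation dist f g := (\int[mu]_x (`|f x - g x| `^ p)%:E)%E.

Lemma roundness_integral (p2 : p <= 2) (fa fb fc fd : T -> R) :
  measurable_fun setT fa -> measurable_fun setT fb ->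
  measurable_fun setT fc -> measurable_fun setT fd ->
  (dist fa fc + dist fb fd <=
   dist fa fb + dist fb fc + dist fc fd + dist fd fa)%E.
Proof.
move=> ma mb mc md.
have M (f g : T -> R) : measurable_fun setT f -> measurable_fun setT g ->
    measurable_fun setT (fun x => (`|f x - g x| `^ p)%:E).
  by move=> mf mg; apply: (@measurable_normp (fun x => f x - g x)); exact: measurable_funB.
have P (f g : T -> R) x : setT x -> (0 <= (`|f x - g x| `^ p)%:E)%E.
  by move=> _; rewrite lee_fin powR_ge0.
have M2 := emeasurable_funD (M _ _ ma mb) (M _ _ mb mc).
have M3 := emeasurable_funD M2 (M _ _ mc md).
have P2 x (xT : setT x) := adde_ge0 (P fa fb x xT) (P fb fc x xT).
have P3 x (xT : setT x) := adde_ge0 (P2 x xT) (P fc fd x xT).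
have mT := @measurableT _ T.
rewrite -(ge0_integralD mu mT (P fa fc) (M _ _ ma mc) (P fb fd) (M _ _ mb md)).
rewrite -(ge0_integralD mu mT (P fa fb) (M _ _ ma mb) (P fb fc) (M _ _ mb mc)).
rewrite -(ge0_integralD mu mT P2 M2 (P fc fd) (M _ _ mc md)).
rewrite -(ge0_integralD mu mT P3 M3 (P fd fa) (M _ _ md ma)).
apply: ge0_le_integral; first exact: measurableT.
- by move=> x xT; exact: (adde_ge0 (P fa fc x xT) (P fb fd x xT)).
- exact: emeasurable_funD (M _ _ ma mc) (M _ _ mb md).
- exact: emeasurable_funD M3 (M _ _ md ma).
- by move=> x _; rewrite -!EFinD lee_fin; apply: roundness_real; rewrite p1 p2.
Qed.

Lemma Lp01_roundness (p2 : p <= 2) : has_roundness V p.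
Proof.
move=> a b c d.
have N (v w : V) : ((`|v - w| `^ p)%:E = \int[mu]_x
    (`|(Lspace_repr v : T -> R) x - (Lspace_repr w : T -> R) x| `^ p)%:E)%E.
  exact: represents_norm (represents_sub (represents_repr v) (represents_repr w)).
rewrite -lee_fin !EFinD.
have E (x1 x2 x3 x4 x5 x6 y1 y2 y3 y4 y5 y6 : \bar R) :
    x1 = y1 -> x2 = y2 -> x3 = y3 -> x4 = y4 -> x5 = y5 -> x6 = y6 ->
    (y1 + y2 <= y3 + y4 + y5 + y6 -> x1 + x2 <= x3 + x4 + x5 + x6)%E.
  by move=> -> -> -> -> -> ->.
apply: (E _ _ _ _ _ _ _ _ _ _ _ _ (N a c) (N b d) (N a b) (N b c) (N c d) (N d a)).
apply: roundness_integral => //.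
- exact: (represents_repr a).1.
- exact: (represents_repr b).1.
- exact: (represents_repr c).1.
- exact: (represents_repr d).1.
Qed.

Lemma Lp01_unit_vector : exists e : V, `|e| = 1.
Proof.
have i1 : (\int[mu]_x (`|(1 : R)| `^ p)%:E = 1)%E.
  rewrite normr1 powR1 integral_cst// mul1e /= /mrestr setTI.
  by rewrite lebesgue_measure_itv/= lte_fin ltr01 sube0.
have [||e re] := @represents_exists R p p1 (fun=> 1).
- exact: measurable_cst.
- by rewrite i1 ltry.
exists e; have := represents_norm re; rewrite i1 => -[].
move=> /(congr1 (fun x => x `^ p^-1)).
by rewrite -powRrM mulfV ?powRr1 ?powR1// gt_eqF// (lt_le_trans _ p1).
Qed.

End Lp01Geometry.

(** * Affine isometric actions on l_p-sums *)

(** A linear isometry of [V] with the l_p-sum of countably many copies of itself, given by its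
    coordinates [P n]; the norm formula contains injectivity. This is the form in which the
    self-similarity of L_p reaches the group side. *)
Definition lp_divisible (R : realType) (V : normedModType R) (p : R) : Prop :=
  exists P : nat -> V -> V,
  [/\ forall n v w, P n (v + w) = P n v + P n w,
      forall n (a : R) v, P n (a *: v) = a *: P n v,
      forall v, ((`|v| `^ p)%:E = \esum_(n in [set: nat]) (`|P n v| `^ p)%:E)%E &
      forall u : nat -> V,
        (\esum_(n in [set: nat]) (`|u n| `^ p)%:E < +oo)%E ->
        exists v, forall n, P n v = u n].

Lemma Lp01_divisible (R : realType) (p : R) (p1 : 1 <= p) :
  lp_divisible (Lp01 p1) p.
Proof.
exists (@piece R p p1); split.
- exact: pieceD.
- exact: pieceZ.
- exact: piece_norm.
- exact: piece_surj.
Qed.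

Lemma powR_inj_ge0 (R : realType) (p : R) : 0 < p ->
  forall x y : R, 0 <= x -> 0 <= y -> x `^ p = y `^ p -> x = y.
Proof.
move=> p0 x y x0 y0 /(congr1 (fun z => z `^ p^-1)).
by rewrite -!powRrM mulfV ?gt_eqF// !powRr1.
Qed.

Lemma powRD_gt0 (R : realType) (x r s : R) : 0 < x ->
  x `^ (r + s) = x `^ r * x `^ s.
Proof. by move=> x0; rewrite powRD// (gt_eqF x0) implybT. Qed.

(** The sum is at most twice the larger term. This serves only for summability, so the constant is
    immaterial. *)
Lemma powR_add_le (R : realType) (p x y : R) : 0 <= p -> 0 <= x -> 0 <= y ->
  (x + y) `^ p <= (2 * x) `^ p + (2 * y) `^ p.
Proof.
move=> p0 x0 y0; have [xy|yx] := leP x y.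
  rewrite (@le_trans _ _ ((2 * y) `^ p))// ?lerDr ?powR_ge0//.
  by rewrite ge0_ler_powR ?nnegrE; lra.
rewrite (@le_trans _ _ ((2 * x) `^ p))// ?lerDl ?powR_ge0//.
by rewrite ge0_ler_powR ?nnegrE; lra.
Qed.

Section InducedAction.
Context (R : realType) (V : normedModType R) (p : R).
Hypotheses (p0 : 0 < p) (divV : lp_divisible V p).
Context (G : groupType) (Y : choiceType) (e : Y -> nat).
Hypothesis bij_e : bijective e.
Variables (sigma : G -> Y -> Y) (A : G -> Y -> V -> V).
Hypothesis sigma1 : forall y, sigma 1%g y = y.
Hypothesis sigmaM : forall g h y, sigma (g * h)%g y = sigma g (sigma h y).
Hypothesis A1 : forall y v, A 1%g y v = v.
Hypothesis AM : forall g h y v, A (g * h)%g y v = A g y (A h (sigma g^-1%g y) v).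
Hypothesis A_isom : forall g y v w, `|A g y v - A g y w| = `|v - w|.
Hypothesis A_affine : forall g y (r : R) v w,
  A g y (r *: v + (1 - r) *: w) = r *: A g y v + (1 - r) *: A g y w.
Hypothesis A_summable : forall g,
  (\esum_(y in [set: Y]) (`|A g y 0| `^ p)%:E < +oo)%E.

Lemma sigma_bij g : bijective (sigma g).
Proof.
exists (sigma g^-1%g) => y; rewrite -sigmaM.
  by rewrite mulVg sigma1.
by rewrite mulgV sigma1.
Qed.

(** On families w over [Y] the action is (g w)(y) = A g y (w (sigma g^-1 y)). Summability is assumed
    for the image of 0 alone: since [A g y] is isometric, the image of any other family differs from
    it by a summable one. *)
Lemma lp_induced_action : exists tau : G -> V -> V, affine_isometric_action tau /\
  forall g, ((`|tau g 0| `^ p)%:E = \esum_(y in [set: Y]) (`|A g y 0| `^ p)%:E)%E.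
Proof.
have [P [PD PZ Pnorm Psurj]] := divV.
pose c y v := P (e y) v.
have cD y v w : c y (v + w) = c y v + c y w by exact: PD.
have cZ y a v : c y (a *: v) = a *: c y v by exact: PZ.
have cB y v w : c y (v - w) = c y v - c y w.
  by rewrite -scaleN1r cD cZ scaleN1r.
have c0 y : c y 0 = 0 by have := cZ y 0 0; rewrite !scale0r.
have cnorm v : ((`|v| `^ p)%:E = \esum_(y in [set: Y]) (`|c y v| `^ p)%:E)%E.
  by rewrite Pnorm (reindex_esum setT setT e)//; by rewrite setTT_bijective.
have csurj (u : Y -> V) :
    (\esum_(y in [set: Y]) (`|u y| `^ p)%:E < +oo)%E ->
    exists v, forall y, c y v = u y.
  have [e' eK e'K] := bij_e; move=> uy.
  have [|v vu] := Psurj (u \o e').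
    rewrite (reindex_esum setT setT e); last by rewrite setTT_bijective.
    by under eq_esum do rewrite /= eK.
  by exists v => y; rewrite /c vu /= eK.
have cinj v w : (forall y, c y v = c y w) -> v = w.
  move=> vw; apply/subr0_eq/normr0_eq0; apply: (powR_inj_ge0 p0) => //.
  apply: EFin_inj; rewrite cnorm powR0 ?gt_eqF// esum1// => y _.
  by rewrite cB vw subrr normr0 powR0// gt_eqF.
pose T g v y := A g y (c (sigma g^-1%g y) v).
have Tsum g v : (\esum_(y in [set: Y]) (`|T g v y| `^ p)%:E < +oo)%E.
  have [w wA] := csurj _ (A_summable g).
  apply: (@le_lt_trans _ _ (\esum_(y in [set: Y]) ((`|c (sigma g^-1%g y) (2 *: v)| `^ p)%:E +
     (`|c y (2 *: w)| `^ p)%:E))%E).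
    apply: le_esum => y _; rewrite -EFinD lee_fin !cZ wA !normrZ (ger0_norm (ler0n _ 2)).
    apply: le_trans (powR_add_le (ltW p0) (normr_ge0 _) (normr_ge0 _)).
    rewrite ge0_ler_powR ?nnegrE ?(ltW p0) ?addr_ge0//.
    rewrite /T -[X in `|X| <= _](subrK (A g y 0)) (le_trans (ler_normD _ _))// lerD2r.
    by rewrite A_isom subr0.
  rewrite esumD//.
  rewrite -cnorm.
  rewrite -(reindex_esum setT setT (sigma g^-1%g) (fun y => (`|c y (2 *: v)| `^ p)%:E)); last first.
    by rewrite setTT_bijective; exact: sigma_bij.
  by rewrite -cnorm -EFinD ltry.
have [tau tauE] : {tau : G -> V -> V | forall g v y, c y (tau g v) = T g v y}.
  exists (fun g v => get [set w | forall y, c y w = T g v y]) => g v.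
  exact: (getPex (csurj _ (Tsum g v))).
exists tau; split; last first.
  by move=> g; rewrite cnorm; apply: eq_esum => y _; rewrite tauE /T c0.
split.
- by move=> v; apply: cinj => y; rewrite tauE /T A1 invg1 sigma1.
- move=> g h v; apply: cinj => y; rewrite !tauE /T tauE /T AM.
  by rewrite invgM sigmaM.
- move=> g v w; apply: (powR_inj_ge0 p0) => //; apply: EFin_inj.
  rewrite !cnorm; under eq_esum do rewrite cB !tauE /T A_isom -cB.
  by rewrite -(reindex_esum setT setT (sigma g^-1%g) (fun y => (`|c y (v - w)| `^ p)%:E))//; by rewrite setTT_bijective; exact: sigma_bij.
- by move=> g r v w; apply: cinj => y; rewrite !(tauE, cD, cZ) /T !(cD, cZ) A_affine.
Qed.

End InducedAction.

(** * Displacement functions of affine isometric actions *)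

Section Displacement.
Context (R : realType) (V : normedModType R).

(** The norm of the cocycle g -> [tau g 0]. Any other base point can be moved to 0 by conjugating
    with a translation, as in [displacement_base]. *)
Definition displacement (G : groupType) (n : G -> R) : Prop :=
  exists tau : G -> V -> V,
    affine_isometric_action tau /\ forall g, n g = `|tau g 0|.

Lemma displacement_ge0 (G : groupType) (n : G -> R) g : displacement n -> 0 <= n g.
Proof. by move=> [tau [_ ->]]. Qed.

Lemma displacement1 (G : groupType) (n : G -> R) : displacement n -> n 1%g = 0.
Proof. by move=> [tau [[t1 _ _ _] ->]]; rewrite t1 normr0. Qed.

Lemma displacement_dist (G : groupType) (tau : G -> V -> V) (x y : G) v :
  affine_isometric_action tau ->
  `|tau x v - tau y v| = `|tau (x^-1 * y)%g v - v|.
Proof.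
move=> [t1 tM tiso _]; rewrite -(tiso x (tau (x^-1 * y)%g v) v) -tM.
by rewrite mulgA mulgV mul1g distrC.
Qed.

Lemma displacementV (G : groupType) (n : G -> R) x : displacement n -> n x^-1%g = n x.
Proof.
move=> [tau [act nE]]; rewrite !nE.
have := displacement_dist x 1%g 0 act; rewrite mulg1.
by case: act => -> _ _ _; rewrite !subr0.
Qed.

Lemma displacementM (G : groupType) (n : G -> R) x y :
  displacement n -> n (x * y)%g <= n x + n y.
Proof.
move=> [tau [[t1 tM tiso _] nE]]; rewrite !nE tM.
rewrite -[X in `|X| <= _](subrK (tau x 0)) addrC.
by rewrite (le_trans (ler_normD _ _))// lerD2l tiso subr0.
Qed.

Lemma displacement_comp (G G' : groupType) (f : G' -> G) (n : G -> R) :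
  f 1%g = 1%g -> {morph f : x y / (x * y)%g} ->
  displacement n -> displacement (n \o f).
Proof.
move=> f1 fM [tau [[t1 tM tiso taff] nE]]; exists (tau \o f); split => [|g].
  by split => [v|g h v|g v w|g r v w] /=; rewrite ?f1 ?t1 ?fM ?tM ?tiso ?taff.
by rewrite /= nE.
Qed.

Lemma displacement_base (G : groupType) (tau : G -> V -> V) v :
  affine_isometric_action tau -> displacement (fun g => `|tau g v - v|).
Proof.
move=> [t1 tM tiso taff]; exists (fun g w => tau g (w + v) - v); split => [|g].
  split.
  - by move=> w; rewrite t1 addrK.
  - by move=> g h w; rewrite subrK tM.
  - by move=> g w u; rewrite opprB addrA subrK tiso opprD addrACA subrr addr0.
  - move=> g r w u; have -> : r *: w + (1 - r) *: u + v =
      r *: (w + v) + (1 - r) *: (u + v).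
      rewrite !scalerDr addrACA; congr +%R.
      by rewrite -scalerDl subrKC scale1r.
    rewrite taff !scalerBr addrACA; congr +%R.
    by rewrite -opprD -scalerDl subrKC scale1r.
by rewrite add0r.
Qed.

Lemma equivariant_displacement (G : groupType) (Psi : G -> V) :
  equivariant_map Psi -> exists2 n : G -> R, displacement n &
    forall x y, `|Psi x - Psi y| = n (x^-1 * y)%g.
Proof.
move=> [tau [act [v PsiE]]]; exists (fun g => `|tau g v - v|).
  exact: displacement_base.
by move=> x y; rewrite !PsiE displacement_dist.
Qed.

Lemma displacement_equivariant (G : groupType) (n : G -> R) : displacement n ->
  exists2 Psi : G -> V, equivariant_map Psi &
    forall x y, `|Psi x - Psi y| = n (x^-1 * y)%g.
Proof.
move=> [tau [act nE]]; exists (fun g => tau g 0).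
  by exists tau; split => //; exists 0.
by move=> x y; rewrite displacement_dist// subr0 nE.
Qed.

Section Sums.
Context (p : R).
Hypotheses (p0 : 0 < p) (divV : lp_divisible V p).

Lemma displacement_lp_sum2 (G : groupType) (n1 n2 : G -> R) :
  displacement n1 -> displacement n2 ->
  exists2 n : G -> R, displacement n &
    forall g, n g `^ p = n1 g `^ p + n2 g `^ p.
Proof.
move=> [t1 [a1 n1E]] [t2 [a2 n2E]].
(* [lp_induced_action] wants an infinite index set, so the group acts trivially on all coordinates
   after the first two. *)
pose A g (i : nat) (v : V) := match i with 0%N => t1 g v | 1%N => t2 g v | _ => v end.
have AE g : (\esum_(i in [set: nat]) (`|A g i 0| `^ p)%:E = (n1 g `^ p + n2 g `^ p)%:E)%E.
  rewrite -nneseries_esumT; last by move=> i; rewrite lee_fin powR_ge0.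
  rewrite (nneseries_split 0 2); last by move=> k; rewrite lee_fin powR_ge0.
  rewrite add0n ereal_series_cond eseries0 ?adde0; last first.
    by move=> [//|] [//|i _]; rewrite /A normr0 powR0// gt_eqF.
  by rewrite big_mkord 2!big_ord_recr/= big_ord0 add0e n1E n2E.
have [||||||||tau [act tauE]] := @lp_induced_action R V p p0 divV G nat id _ (fun=> id) A.
- by exists id.
- by [].
- by [].
- by case: a1 a2 => [h1 _ _ _] [h2 _ _ _] [|[|i]] v /=.
- by case: a1 a2 => [_ h1 _ _] [_ h2 _ _] g h [|[|i]] v /=.
- by case: a1 a2 => [_ _ h1 _] [_ _ h2 _] g [|[|i]] v w /=.
- case: a1 a2 => [_ _ _ h1] [_ _ _ h2] g [|[|i]] r v w //=.
- by move=> g; rewrite AE ltry.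
exists (fun g => `|tau g 0|); first by exists tau.
by move=> g; apply: EFin_inj; rewrite tauE AE.
Qed.

(** The formal coboundary of the family y -> [F y *: v]. Only the variations of [F] under the group
    must be p-summable, not [F] itself, and this is what allows unbounded displacements. *)
Lemma displacement_coboundary (G : groupType) (Y : choiceType) (e : Y -> nat)
    (sigma : G -> Y -> Y) (F : Y -> R) (v : V) :
  `|v| = 1 -> bijective e -> (forall y, sigma 1%g y = y) ->
  (forall g h y, sigma (g * h)%g y = sigma g (sigma h y)) ->
  (forall g, (\esum_(y in [set: Y]) (`|F (sigma g^-1%g y) - F y| `^ p)%:E < +oo)%E) ->
  exists2 n : G -> R, displacement n & forall g,
    ((n g `^ p)%:E = \esum_(y in [set: Y]) (`|F (sigma g^-1%g y) - F y| `^ p)%:E)%E.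
Proof.
move=> v1 bij_e s1 sM Fsum.
pose A g y (w : V) := w + (F (sigma g^-1%g y) - F y) *: v.
have A0 g y : `|A g y 0| = `|F (sigma g^-1%g y) - F y|.
  by rewrite /A add0r normrZ v1 mulr1.
have [||||||||tau [act tauE]] := @lp_induced_action R V p p0 divV G Y e _ sigma A.
- by [].
- by [].
- by [].
- by move=> y w; rewrite /A invg1 s1 subrr scale0r addr0.
- move=> g h y w; rewrite /A invgM sM -addrA -scalerDl.
  by rewrite addrA subrK.
- by move=> g y w u; rewrite /A opprD addrACA subrr addr0.
- move=> g y r w u; rewrite /A !scalerDr addrACA; congr +%R.
  by rewrite -scalerDl subrKC scale1r.
- by move=> g; under eq_esum do rewrite A0; exact: Fsum.
exists (fun g => `|tau g 0|); first by exists tau.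
by move=> g; rewrite tauE; apply: eq_esum => y _; rewrite A0.
Qed.

End Sums.
End Displacement.

(** * Word lengths *)

Section Words.
Variables (G : groupType) (S : seq G).
Local Open Scope group_scope.

Lemma is_word_cat (g h : G) s s' :
  is_word S g s -> is_word S h s' -> is_word S (g * h) (s ++ s').
Proof.
move=> [sS gE] [s'S hE]; split; first by rewrite all_cat sS.
by rewrite gE hE big_cat.
Qed.

Lemma is_wordV (g : G) s : is_word S g s -> exists2 s', is_word S g^-1 s' & size s' = size s.
Proof.
elim: s g => [|x s IH] g [sS gE].
  by exists [::] => //; split=> //; rewrite gE !big_nil invg1.
move: sS gE => /= /andP[xS sS]; rewrite big_cons => gE.
have [s' ws' ss'] := IH _ (conj sS erefl).
exists (s' ++ [:: x^-1]); last by rewrite size_cat/= addn1 ss'.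
rewrite gE invgM; apply: is_word_cat => //; split; last by rewrite big_seq1.
by rewrite /= andbT invgK orbC.
Qed.

Context (genS : generates S).
Local Notation len := (word_length genS).

Lemma word_lengthP g : exists2 s, is_word S g s & size s = len g.
Proof.
rewrite /word_length; case: ex_minnP => n /asboolP[s ws sn] _.
by exists s.
Qed.

Lemma word_length_le g s : is_word S g s -> (len g <= size s)%N.
Proof.
move=> ws; rewrite /word_length; case: ex_minnP => n _; apply.
by apply/asboolP; exists s.
Qed.

Lemma word_length1 : len 1 = 0%N.
Proof.
by apply/eqP; rewrite -leqn0 (@word_length_le _ [::])//; split; rewrite ?big_nil.
Qed.

Lemma word_length_eq0 g : len g = 0%N -> g = 1.
Proof.
have [s [_ ->] <-] := word_lengthP g => /size0nil ->.
by rewrite big_nil.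
Qed.

Lemma word_lengthM g h : (len (g * h) <= len g + len h)%N.
Proof.
have [s ws <-] := word_lengthP g; have [s' ws' <-] := word_lengthP h.
by rewrite -size_cat word_length_le//; exact: is_word_cat.
Qed.

Lemma word_lengthV g : len g^-1 = len g.
Proof.
suff le h : (len h^-1 <= len h)%N.
  by apply/eqP; rewrite eqn_leq le/= -{1}(invgK g) le.
have [s /is_wordV[s' ws' <-] <-] := word_lengthP h.
exact: word_length_le.
Qed.

Fixpoint word_ball (n : nat) : seq G :=
  if n is n'.+1 then
    word_ball n' ++ [seq x * y | x <- S ++ [seq x^-1 | x <- S], y <- word_ball n']
  else [:: 1].

Lemma word_ballP n g : (len g <= n)%N -> g \in word_ball n.
Proof.
have [s [+ ->] <-] := word_lengthP g.
elim: n s => [|n IH] [|x s]//=; first by rewrite big_nil mem_head.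
  by rewrite mem_cat IH ?big_nil.
move=> /andP[xS sS]; rewrite ltnS => sn; rewrite mem_cat big_cons; apply/orP; right.
apply: allpairs_f; last exact: IH.
rewrite mem_cat; case/orP: xS => [->//|xS]; apply/orP; right.
by apply/mapP; exists x^-1; rewrite ?invgK.
Qed.

Lemma word_length_unbounded : infinite_set [set: G] ->
  forall n, exists g, (n <= len g)%N.
Proof.
move=> Ginf n; apply/not_existsP => h; apply: Ginf.
apply: (@sub_finite_set _ _ [set` word_ball n]); last exact: finite_seq.
move=> g _ /=; apply: word_ballP; rewrite leqNgt; apply/negP => /ltnW.
exact: h.
Qed.

Lemma fin_gen_countable : countable [set: G].
Proof.
have -> : [set: G] = \bigcup_n [set` word_ball n].
  by apply/seteqP; split => // g _; exists (len g) => //=; exact: word_ballP.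
by apply: bigcup_countable => // n _; apply: finite_set_countable; exact: finite_seq.
Qed.

(** Applied to displacements, to lamp sums and to the length of [at0 h]. The summand 1 in [L] keeps
    it positive even for an empty [S]. *)
Lemma word_length_lipschitz (R : realType) (N : G -> R) :
  (N 1%g <= 0)%R -> (forall g h, N (g * h)%g <= N g + N h)%R ->
  exists2 L : R, (0 < L)%R & forall g, (N g <= L * (len g)%:R)%R.
Proof.
move=> N1 NM.
pose L : R := (1 + \sum_(x <- S) (`|N x| + `|N x^-1%g|))%R.
have sum0 (s : seq G) : (0 <= \sum_(x <- s) (`|N x| + `|N x^-1%g|))%R.
  by apply: sumr_ge0 => x _; rewrite addr_ge0.
have NL x : x \in S -> (N x <= L /\ N x^-1%g <= L)%R.
  move=> xS; have : (`|N x| + `|N x^-1%g| <= \sum_(x <- S) (`|N x| + `|N x^-1%g|))%R.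
    rewrite (big_rem x)//= lerDl; exact: sum0.
  rewrite /L; move: (\sum_(x <- S) _)%R => s.
  have := ler_norm (N x); have := ler_norm (N x^-1%g).
  have := normr_ge0 (N x); have := normr_ge0 (N x^-1); split; lra.
exists L; first by rewrite /L ltr_wpDr.
move=> g; have [s [+ ->] <-] := word_lengthP g.
elim: s => [|x s IH] /=; first by rewrite big_nil mulr0.
move=> /andP[xS /IH h]; rewrite big_cons (le_trans (NM _ _))//.
rewrite -natr1 mulrDr mulr1 addrC lerD//.
case/orP: xS => [/NL[]//|/NL[_]]; by rewrite invgK.
Qed.

End Words.

(** * The compression exponent in terms of displacements *)

Section Admissible.
Context (R : realType) (V : normedModType R).
Context (G : groupType) (S : seq G) (genS : generates S).

Definition admissible (alpha : R) : Prop :=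
  exists2 n : G -> R, displacement V n & exists2 c : R, 0 < c &
    forall g, (0 < word_length genS g)%N ->
      c * (word_length genS g)%:R `^ alpha <= n g.

Lemma displacement_lipschitz (n : G -> R) : displacement V n ->
  exists2 L : R, 0 < L & forall g, n g <= L * (word_length genS g)%:R.
Proof.
move=> dn; apply: word_length_lipschitz; first by rewrite (displacement1 dn).
by move=> g h; exact: displacementM dn.
Qed.

(** By equivariance [Psi x - Psi y] has a norm depending only on x^-1 y. The bound on the
    compression function at t = |g| gives the bound at [g], and conversely t^alpha is monotone in t;
    the Lipschitz condition is supplied by [displacement_lipschitz]. *)
Lemma equivariant_exponentE : equivariant_exponent V genS =
  ereal_sup ([set 0%E] `|` [set alpha%:E | alpha in
    [set alpha : R | 0 <= alpha /\ admissible alpha]]).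
Proof.
have adm (Psi : G -> V) (n : G -> R) : displacement V n ->
    (forall x y, `|Psi x - Psi y| = n (x^-1 * y)%g) ->
    forall alpha c : R, 0 <= alpha -> 0 < c ->
    (forall t : R, 1 <= t -> ((c * t `^ alpha)%:E <= compression_fun genS Psi t)%E) <->
    (forall g, (0 < word_length genS g)%N ->
      c * (word_length genS g)%:R `^ alpha <= n g).
  move=> dn Pn alpha c a0 c0; split => [h g g0|h t t1].
    have := h (word_length genS g)%:R; rewrite ler1n => /(_ g0).
    move=> /le_trans h'; rewrite -lee_fin; apply: h'; apply: ereal_inf_lbound.
    by exists (1%g, g); rewrite /= /word_dist ?Pn invg1 mul1g.
  apply: le_ereal_inf_tmp => _ [[x y] /= txy <-]; rewrite lee_fin Pn.
  have xy1 : 1 <= word_dist R genS x y by exact: le_trans txy.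
  have := h (x^-1 * y)%g; rewrite -(ltr0n R) => /(_ (lt_le_trans ltr01 xy1)).
  apply: le_trans; rewrite ler_pM2l// ge0_ler_powR ?nnegrE//; lra.
apply/eqP; rewrite eq_le; apply/andP; split.
  apply: ge_ereal_sup => _ [Psi [_ /equivariant_displacement[n dn Pn]] <-].
  apply: ge_ereal_sup => _ [->|[alpha [a0 [c c0 ac]] <-]].
    by apply: ereal_sup_ubound; left.
  apply: ereal_sup_ubound; right; exists alpha => //; split => //.
  exists n => //; exists c => //.
  by have /(_ alpha c a0 c0)[/(_ ac)] := adm Psi n dn Pn.
apply: ge_ereal_sup => _ [->|[alpha [a0 [n dn [c c0 ac]]] <-]].
  (* The value 0 must come from an actual equivariant map: the zero map, for the trivial action. *)
  apply: (@le_trans _ _ (compression_exponent genS (fun=> 0 : V))).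
    by apply: ereal_sup_ubound; left.
  apply: ereal_sup_ubound; exists (fun=> 0) => //; split.
    by exists 0 => x y; rewrite subrr normr0 mul0r.
  exists (fun _ v => v); split; last by exists 0.
  by split.
have [Psi ePsi Pn] := displacement_equivariant dn.
apply: (@le_trans _ _ (compression_exponent genS Psi)).
  apply: ereal_sup_ubound; right; exists alpha => //; split => //.
  by exists c => //; have /(_ alpha c a0 c0)[_ /(_ ac)] := adm Psi n dn Pn.
apply: ereal_sup_ubound; exists Psi => //; split => //.
have [L L0 nL] := displacement_lipschitz dn.
by exists L => x y; rewrite Pn.
Qed.

Lemma admissible_le1 alpha : infinite_set [set: G] -> 0 <= alpha ->
  admissible alpha -> alpha <= 1.
Proof.
move=> Ginf a0 [n dn [c c0 nc]]; have [L L0 nL] := displacement_lipschitz dn.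
rewrite leNgt; apply/negP => a1.
(* Past [M] the lower bound c l^alpha exceeds the Lipschitz bound L l. *)
pose M := ((L / c) `^ (alpha - 1)^-1).
have [g gM] := word_length_unbounded genS Ginf (Num.truncn M).+2.
have g0 : (0 < word_length genS g)%N by exact: leq_trans gM.
have := le_trans (nc g g0) (nL g).
set l := (word_length genS g)%:R.
have Ml : M < l.
  apply: lt_le_trans (truncnS_gt _) _; rewrite ler_nat.
  exact: leq_trans gM.
have l0 : 0 < l by rewrite ltr0n.
have -> : l `^ alpha = l `^ (alpha - 1) * l.
  by rewrite -{3}(powRr1 (ltW l0)) -powRD_gt0// subrK.
rewrite mulrA ler_pM2r// -ler_pdivlMl// mulrC leNgt => /negP; apply.
have a10 : 0 < alpha - 1 by rewrite subr_gt0.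
have -> : L / c = M `^ (alpha - 1).
  by rewrite /M -powRrM mulVf ?gt_eqF// powRr1// divr_ge0// ltW.
by rewrite gt0_ltr_powR ?nnegrE ?powR_ge0// ltW.
Qed.

End Admissible.

(** * Elements and word lengths of the wreath product *)

Local Notation lamps_fun := Defs.lamps_fun.

Section WreathElements.
Variable H : groupType.
Local Open Scope group_scope.
Implicit Types (f : lamps H) (x y : wreath H).

Definition lamp (k : int) (h : H) : lamps H := [fsfun j in [fset k]%fset => h].

Lemma lampE k h j : lamps_fun (lamp k h) j = if j == k then h else 1.
Proof. by rewrite /lamps_fun fsfunE inE. Qed.

Lemma lamps_ext f f' : (forall k, lamps_fun f k = lamps_fun f' k) -> f = f'.
Proof. exact: lampsP. Qed.

Lemma lamps_mulgE f f' k : lamps_fun (f * f') k = lamps_fun f k * lamps_fun f' k.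
Proof. exact: lamps_mulE. Qed.

Lemma lamps_invgE f k : lamps_fun f^-1 k = (lamps_fun f k)^-1.
Proof. exact: lamps_invE. Qed.

Lemma lamps1E k : lamps_fun (1 : lamps H) k = 1.
Proof. exact: lamps_oneE. Qed.

Lemma lamps_translateE n f k : lamps_fun (translate n f) k = lamps_fun f (k - n)%R.
Proof. exact: translateE. Qed.

Definition at0 (h : H) : wreath H := (lamp 0%R h, 0%R).
Definition shift (m : int) : wreath H := (1, m).

Lemma wreathP x y : (forall k, lamps_fun x.1 k = lamps_fun y.1 k) -> x.2 = y.2 -> x = y.
Proof. by case: x y => [f m] [g n] /= /lampsP -> ->. Qed.

Lemma wreath_mul1E x y k :
  lamps_fun (x * y).1 k = lamps_fun x.1 k * lamps_fun y.1 (k - x.2)%R.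
Proof.
by rewrite -[LHS]/(lamps_fun (x.1 * translate x.2 y.1) k) lamps_mulgE lamps_translateE.
Qed.

Lemma wreath_mul2E x y : (x * y).2 = (x.2 + y.2)%R.
Proof. by []. Qed.

Lemma wreath_inv1E x k : lamps_fun (x^-1).1 k = (lamps_fun x.1 (k + x.2)%R)^-1.
Proof.
rewrite -[LHS]/(lamps_fun (translate (- x.2)%R x.1^-1) k).
by rewrite lamps_translateE lamps_invgE opprK.
Qed.

Lemma wreath_inv2E x : (x^-1).2 = (- x.2)%R.
Proof. by []. Qed.

Lemma wreath1E1 k : lamps_fun (1 : wreath H).1 k = 1.
Proof. exact: lamps1E. Qed.

Lemma at01 : at0 1 = 1.
Proof.
by apply: wreathP => // k; rewrite lampE wreath1E1 if_same.
Qed.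

Lemma at0M : {morph at0 : h h' / h * h'}.
Proof.
move=> h h'; apply: wreathP => [k|]; last by rewrite wreath_mul2E addr0.
by rewrite wreath_mul1E !lampE subr0; case: eqP => //; rewrite mulg1.
Qed.

Lemma shift0 : shift 0 = 1. Proof. by []. Qed.

Lemma shiftD (m n : int) : shift (m + n)%R = shift m * shift n.
Proof.
apply: wreathP => [k|//]; by rewrite wreath_mul1E !lamps1E mulg1.
Qed.

(** The lamplighter's walk: set the lamp at the current position, then step to the right. *)
Lemma sweepE (u : nat -> H) (n : nat) :
  let x := \prod_(j < n) (at0 (u j) * shift 1) in
  x.2 = n%:Z /\ forall k, lamps_fun x.1 k =
    if k is Posz j then if (j < n)%N then u j else 1 else 1.
Proof.
elim: n => [|n IH] x; rewrite /x.
  by rewrite big_ord0; split => // -[j|j]; rewrite wreath1E1.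
rewrite big_ord_recr; case: IH; set y := \prod_(i < n) _ => y2 y1; split.
  by rewrite !wreath_mul2E y2 /= add0r intS addrC.
move=> k; rewrite 2!wreath_mul1E lamps1E mulg1 y1 y2 lampE /= subr_eq0.
case: k => [j|j] //=; last by rewrite mul1g.
rewrite eqz_nat ltnS; case: ltngtP => [_|_|->]; rewrite ?mulg1 ?mul1g//.
Qed.

(** Walk to -r, sweep the 2 r + 1 positions up to r, which ends at r + 1, then walk to [m]. *)
Lemma wreath_decomposition (f : lamps H) (m : int) (r : nat) :
  (forall k, lamps_fun f k != 1 -> (`|k| <= r)%N) ->
  (f, m) = shift (- r%:Z)%R *
    (\prod_(j < r.*2.+1) (at0 (lamps_fun f (j%:Z - r%:Z)%R) * shift 1)) *
    shift (m - (r.+1)%:Z)%R.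
Proof.
move=> fr; set P := (\prod_(j < _) _).
have [P2 P1] := sweepE (fun j => lamps_fun f (j%:Z - r%:Z)%R) r.*2.+1.
rewrite -/P in P1 P2.
apply: wreathP => [k|]; last first.
  by rewrite !wreath_mul2E P2 /=; lia.
rewrite 2!wreath_mul1E !lamps1E mulg1 mul1g P1 /= opprK.
case: (boolP (lamps_fun f k == 1)) => [/eqP fk1|/fr kr].
  rewrite fk1; case E : (k + r%:Z)%R => [j|j] //; case: ifP => // _.
  by rewrite -E addrK fk1.
have -> : (k + r%:Z)%R = Posz (absz (k + r%:Z)%R) by lia.
rewrite ifT; last lia.
by congr lamps_fun; lia.
Qed.

End WreathElements.

Section WreathLength.
Context (R : realType) (H : groupType).

Definition lamp_sum (N : H -> R) (f : lamps H) : R :=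
  \sum_(k <- finsupp (f : {fsfun int -> H with 1%g})) N (lamps_fun f k).

Lemma mem_finsupp_lamps (f : lamps H) k :
  (k \in finsupp (f : {fsfun int -> H with 1%g})) = (lamps_fun f k != 1%g).
Proof. by rewrite mem_finsupp. Qed.

(** Trivial lamps contribute nothing, so lamp sums of different elements or of different functions
    can be compared over one common list of positions. *)
Lemma lamp_sumE (N : H -> R) (f : lamps H) (s : seq int) : N 1%g = 0 -> uniq s ->
  (forall k, lamps_fun f k != 1%g -> k \in s) ->
  lamp_sum N f = \sum_(k <- s) N (lamps_fun f k).
Proof.
move=> N1 us fs; rewrite /lamp_sum.
rewrite (bigID (fun k => lamps_fun f k == 1%g) predT) /= big1 ?add0r; last first.
  by move=> k /eqP ->.
rewrite [RHS](bigID (fun k => lamps_fun f k == 1%g)) /= [X in _ = X + _]big1 ?add0r; last first.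
  by move=> k /eqP ->.
rewrite -big_filter -[RHS]big_filter; apply: perm_big.
apply: uniq_perm; rewrite ?filter_uniq ?fset_uniq//.
move=> k; rewrite !mem_filter mem_finsupp_lamps.
by case: (boolP (_ == _)) => //= /fs ->.
Qed.

Lemma lamp_sumM (N : H -> R) (x y : wreath H) :
  N 1%g = 0 -> (forall g h, N (g * h)%g <= N g + N h) ->
  lamp_sum N (x * y)%g.1 <= lamp_sum N x.1 + lamp_sum N y.1.
Proof.
move=> N1 NM.
pose s := undup (enum_fset (finsupp (x.1 : {fsfun int -> H with 1%g})) ++
  [seq k + x.2 | k <- enum_fset (finsupp (y.1 : {fsfun int -> H with 1%g}))]).
have us : uniq s by exact: undup_uniq.
have xs k : lamps_fun x.1 k != 1%g -> k \in s.
  by move=> xk; rewrite mem_undup mem_cat mem_finsupp xk.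
have ys k : lamps_fun y.1 (k - x.2) != 1%g -> k \in s.
  move=> yk; rewrite mem_undup mem_cat; apply/orP; right; apply/mapP.
  by exists (k - x.2); rewrite ?mem_finsupp// subrK.
have xys k : lamps_fun (x * y)%g.1 k != 1%g -> k \in s.
  rewrite wreath_mul1E; apply: contraR => ks.
  have [/xs|/negPn/eqP ->] := boolP (lamps_fun x.1 k != 1%g); first by rewrite (negPf ks).
  have [/ys|/negPn/eqP ->] := boolP (lamps_fun y.1 (k - x.2) != 1%g); first by rewrite (negPf ks).
  by rewrite mulg1.
rewrite (lamp_sumE N1 us xys) (lamp_sumE N1 us xs).
rewrite (@lamp_sumE N y.1 [seq k - x.2 | k <- s])//; last 2 first.
- by rewrite map_inj_uniq//; exact: addIr.
- move=> k yk; apply/mapP; exists (k + x.2); last by rewrite addrK.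
  by apply: ys; rewrite addrK.
rewrite big_map -big_split/=; apply: ler_sum => k _.
by rewrite wreath_mul1E.
Qed.

Lemma lamp_sum_ge0 (N : H -> R) f : (forall h, 0 <= N h) -> 0 <= lamp_sum N f.
Proof. by move=> N0; apply: sumr_ge0 => k _. Qed.

Context (S : seq H) (genS : generates S).
Context (S' : seq (wreath H)) (genS' : generates S').
Local Notation len h := ((word_length genS h)%:R : R).
Local Notation len' x := ((word_length genS' x)%:R : R).

Lemma lamp_sum_le_length : exists2 L : R, 0 < L &
  forall x, lamp_sum (fun h => len h) x.1 <= L * len' x.
Proof.
have N1 : len 1%g = 0 by rewrite word_length1.
apply: (word_length_lipschitz genS' (N := fun x => lamp_sum (fun h => len h) x.1)).
  by rewrite (@lamp_sumE _ _ [::])//= ?big_nil// => k; rewrite wreath1E1 eqxx.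
move=> x y; apply: lamp_sumM => // g h; rewrite -natrD ler_nat.
exact: word_lengthM.
Qed.

Lemma length_at0 : exists2 L : R, 0 < L & forall h, len' (at0 h) <= L * len h.
Proof.
apply: (word_length_lipschitz genS (N := fun h => len' (at0 h))).
  by rewrite at01 word_length1.
by move=> g h; rewrite at0M -natrD ler_nat; exact: word_lengthM.
Qed.

Lemma length_shift (m : int) : len' (shift H m) <= len' (shift H 1) * `|m|%N%:R.
Proof.
have pos (n : nat) : len' (shift H n) <= len' (shift H 1) * n%:R.
  elim: n => [|n IH]; first by rewrite shift0 word_length1 mulr0.
  rewrite intS shiftD -natr1 mulrDr mulr1 addrC (@le_trans _ _ (len' (shift H 1) + len' (shift H n)))//.
    by rewrite -natrD ler_nat; exact: word_lengthM.
  by rewrite lerD2l.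
case: m => n; first exact: pos.
have -> : shift H (Negz n) = (shift H n.+1)^-1%g.
  by apply: (@mulIg _ (shift H n.+1)); rewrite mulVg -shiftD NegzE addNr.
by rewrite word_lengthV; exact: pos.
Qed.

Lemma length_le_lamp_sum : exists2 C : R, 0 < C & forall f (m : int) (r : nat),
  (forall k, lamps_fun f k != 1%g -> (`|k| <= r)%N) -> (`|m| <= r)%N ->
  len' (f, m) <= C * (1 + lamp_sum (fun h => len h) f + r%:R).
Proof.
have [L L0 at0L] := length_at0.
set T := len' (shift H 1); have T0 : 0 <= T by exact: ler0n.
(* The walk makes at most r + (2 r + 1) + (2 r + 1) unit shifts, which gives the 5. *)
exists (L + 5 * T); first by rewrite ltr_wpDr// mulr_ge0.
move=> f m r fr mr; rewrite (wreath_decomposition m fr).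
have subM (x y : wreath H) : len' (x * y)%g <= len' x + len' y.
  by rewrite -natrD ler_nat; exact: word_lengthM.
have subP (n : nat) (u : 'I_n -> wreath H) :
    len' (\prod_(j < n) u j)%g <= \sum_(j < n) len' (u j).
  rewrite -natr_sum ler_nat; elim/big_ind2 : _ => //.
    by rewrite word_length1.
  by move=> x a y b xa yb; rewrite (leq_trans (word_lengthM _ _ _))// leq_add.
apply: le_trans (subM _ _) _; apply: le_trans (lerD (subM _ _) (lexx _)) _.
have h1 := length_shift (- r%:Z); have h2 := length_shift (m - (r.+1)%:Z).
have h3 : len' (\prod_(j < r.*2.+1) (at0 (lamps_fun f (j%:Z - r%:Z)%R) * shift H 1))%g
    <= L * lamp_sum (fun h => len h) f + T * r.*2.+1%:R.
  apply: le_trans (subP _ _) _.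
  have -> : lamp_sum (fun h => len h) f =
      \sum_(j < r.*2.+1) len (lamps_fun f (j%:Z - r%:Z)).
    rewrite (@lamp_sumE _ f [seq (j%:Z - r%:Z) | j <- iota 0 r.*2.+1])//.
    - by rewrite big_map -(big_mkord xpredT (fun j => len (lamps_fun f (j%:Z - r%:Z)))) /index_iota subn0.
    - by rewrite word_length1.
    - by rewrite map_inj_uniq ?iota_uniq// => i j /addIr [].
    - move=> k /fr kr; apply/mapP; exists (absz (k + r%:Z)); last by lia.
      by rewrite mem_iota; lia.
  rewrite mulr_sumr (_ : T * _ = \sum_(j < r.*2.+1) T); last first.
    by rewrite sumr_const card_ord mulr_natr.
  by rewrite -big_split/=; apply: ler_sum => j _; rewrite (le_trans (subM _ _))// lerD.
have S0 : 0 <= lamp_sum (fun h => len h) f by apply: lamp_sum_ge0 => h; exact: ler0n.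
have e1 : (`|- r%:Z|%N)%:R = r%:R :> R by congr _%:R; lia.
have e2 : (`|m - (r.+1)%:Z|%N)%:R <= 2 * r%:R + 1 :> R.
  by rewrite -(natrM _ 2) natr1 ler_nat; lia.
have e3 : r.*2.+1%:R = 2 * r%:R + 1 :> R.
  by rewrite -(natrM _ 2) natr1 mul2n.
have {}h2 : len' (shift H (m - (r.+1)%:Z)) <= T * (2 * r%:R + 1).
  by rewrite (le_trans h2)// ler_wpM2l.
have r0 : 0 <= r%:R :> R by exact: ler0n.
rewrite e1 in h1; rewrite e3 in h3.
apply: le_trans (lerD (lerD h1 h3) h2) _; rewrite -/T; nra.
Qed.

End WreathLength.

(** * Cocycles of the wreath product *)

Lemma countably_infinite_bijection (Y : choiceType) :
  countable [set: Y] -> infinite_set [set: Y] ->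
  exists e : Y -> nat, bijective e.
Proof.
move=> cY iY; have /card_set_bijP[e] := eq_card_nat cY iY.
by rewrite setTT_bijective => be; exists e.
Qed.

Lemma infinite_setT_inj (Y : choiceType) (u : nat -> Y) :
  injective u -> infinite_set [set: Y].
Proof.
move=> uinj Yfin; apply: infinite_nat.
rewrite -(@preimage_setT _ _ u); apply: finite_preimage => //.
exact: in2W.
Qed.

Section SeriesOverTypes.
Context (R : realType) (Y : choiceType) (u : nat -> Y).
Hypothesis uinj : injective u.

Lemma esum_range (a : Y -> \bar R) : (forall y, 0 <= a y)%E ->
  (forall y, ~ range u y -> a y = 0%E) ->
  (\esum_(y in [set: Y]) a y = \sum_(n <oo) a (u n))%E.
Proof.
move=> a0 aout; rewrite nneseries_esumT//.
rewrite -(@esum_image _ _ _ setT u a (in2W uinj)) [RHS]esum_mkcond; apply: eq_esum => y _.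
by case: ifPn => //; rewrite notin_setE => /aout.
Qed.

Lemma esum_ge_series (a : Y -> \bar R) (K : nat) : (forall y, 0 <= a y)%E ->
  (\sum_(0 <= n < K) a (u n) <= \esum_(y in [set: Y]) a y)%E.
Proof.
move=> a0; apply: (@le_trans _ _ (\sum_(n <oo) a (u n))%E).
  exact: nneseries_lim_ge.
rewrite nneseries_esumT// -(@esum_image _ _ _ setT u a (in2W uinj)) esum_mkcond.
by apply: le_esum => y _; case: ifP.
Qed.

End SeriesOverTypes.

Section PowerSums.
Context (R : realType).

(* Telescoping: the general term is at most the increment of
   [- j ^ (- eta) / eta]. *)
Lemma pseries_le (eta : R) (n : nat) : 0 < eta ->
  \sum_(0 <= j < n) (j.+1%:R : R) `^ (- eta - 1) <= 1 + eta^-1.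
Proof.
move=> e0.
have step (j : nat) : (j.+2%:R : R) `^ (- eta - 1) <=
    eta^-1 * (j.+1%:R `^ (- eta) - j.+2%:R `^ (- eta)).
  have x0 : 0 < j.+1%:R :> R by [].
  have y0 : 0 < j.+2%:R :> R by [].
  have xy : j.+2%:R = j.+1%:R + 1 :> R by rewrite -natr1.
  move: (j.+1%:R : R) (j.+2%:R : R) x0 y0 xy => x y x0 y0 xy.
  rewrite powRD_gt0// (_ : y `^ (- 1) = y^-1); last by rewrite powR_inv1// ltW.
  rewrite ler_pdivlMl// lerBrDl.
  have -> : y `^ (- eta) + eta * (y `^ (- eta) / y) = y `^ (- eta) * (1 + eta / y).
    by ring.
  apply: (@le_trans _ _ (y `^ (- eta) * expR (eta / y))).
    by rewrite ler_wpM2l ?powR_ge0// expR_ge1Dx.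
  rewrite /powR !gt_eqF// -expRD ler_expR !mulNr.
  have : ln (x / y) <= - y^-1.
    have -> : x / y = 1 + - y^-1 by rewrite xy; field; lra.
    by apply: le_ln1Dx; rewrite ltrN2 invf_lt1// xy; lra.
  rewrite ln_div// => h.
  have : eta * (ln x - ln y + y^-1) <= 0 by rewrite pmulr_rle0//; lra.
  lra.
have tail m : \sum_(0 <= j < m.+1) (j.+1%:R : R) `^ (- eta - 1) <=
    1 + eta^-1 * (1 - m.+1%:R `^ (- eta)).
  elim: m => [|m IH]; first by rewrite big_nat1 !powR1 subrr mulr0 addr0.
  rewrite big_nat_recr//=; apply: le_trans (lerD IH (step m)) _.
  by rewrite -addrA -mulrDr addrA subrK.
case: n => [|n]; first by rewrite big_nil addr_ge0// invr_ge0 ltW.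
apply: le_trans (tail n) _; rewrite lerD2l ger_pMr ?invr_gt0//.
Qed.

Definition slow_weight (beta : R) (k : nat) : R :=
  \sum_(0 <= j < k) (j.+1%:R : R) `^ beta.

(** As beta <= 0, each of the k + 1 summands of [slow_weight beta k.+1] is at least K^beta. The
    upper half of the range of k, with at least K/2 indices and k + 1 >= K/2, already gives the
    bound. *)
Lemma slow_weight_sum (p beta : R) (K : nat) : 1 <= p -> beta <= 0 -> (0 < K)%N ->
  2^-1 `^ (p + 1) * (K%:R : R) `^ (p * beta + p + 1) <=
  \sum_(0 <= k < K) slow_weight beta k.+1 `^ p.
Proof.
move=> p1 b0 K0; have p0 : 0 <= p by lra.
have k0 : 0 < K%:R :> R by rewrite ltr0n.
have W k : (k < K)%N -> k.+1%:R * K%:R `^ beta <= slow_weight beta k.+1.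
  move=> kK; rewrite /slow_weight mulr_natl -[X in _ *+ X]subn0 -sumr_const_nat.
  rewrite big_nat [leRHS]big_nat; apply: ler_sum => j /andP[_ jk].
  have j0 : 0 < j.+1%:R :> R by [].
  rewrite -[beta]opprK !(powRN _ (- beta)) lef_pV2 ?posrE ?powR_gt0//.
  rewrite ge0_ler_powR ?oppr_ge0 ?nnegrE ?ler_nat//.
  exact: leq_trans jk kK.
have c : (2^-1 * K%:R) `^ p * K%:R `^ (p * beta) * (2^-1 * K%:R) =
    2^-1 `^ (p + 1) * (K%:R : R) `^ (p * beta + p + 1).
  rewrite powRM// !powRD_gt0// ?(powRr1 (ltW k0)) ?invr_gt0// powRr1//; ring.
rewrite -c (big_cat_nat (n := K./2))//=; last lia.
rewrite -[leLHS]add0r lerD//; first by apply: sumr_ge0 => k _; exact: powR_ge0.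
apply: (@le_trans _ _ (\sum_(K./2 <= k < K) ((2^-1 * K%:R) `^ p * K%:R `^ (p * beta)))).
  rewrite sumr_const_nat -[leRHS]mulr_natr ler_wpM2l ?mulr_ge0 ?powR_ge0//.
  rewrite natrB; last lia.
  have : (K./2).*2%:R <= K%:R :> R by rewrite ler_nat; lia.
  rewrite -mul2n natrM; lra.
rewrite [leLHS]big_nat [leRHS]big_nat; apply: ler_sum => k /andP[Kk kK].
rewrite mulrC (mulrC p) powRrM -powRM ?mulr_ge0 ?powR_ge0//.
rewrite ge0_ler_powR ?nnegrE ?mulr_ge0 ?powR_ge0//.
  by apply: sumr_ge0 => j _; exact: powR_ge0.
apply: le_trans (W _ kK); rewrite mulrC ler_wpM2r ?powR_ge0//.
rewrite ler_pdivrMl// -(natrM _ 2) ler_nat; lia.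
Qed.

End PowerSums.

Section LampSum.
Context (R : realType) (V : normedModType R) (p : R) (H : groupType).
Hypotheses (p0 : 0 < p) (divV : lp_divisible V p).

(** Families over Z are translated by [x.2], and the lamp at k acts on coordinate k through the
    given action of [H]. *)
Lemma displacement_lamp_sum (n : H -> R) : displacement V n ->
  exists2 n' : wreath H -> R, displacement V n' &
    forall x, n' x `^ p = lamp_sum (fun h => n h `^ p) x.1.
Proof.
move=> dn; have n1 := displacement1 dn; case: dn => tau [[t1 tM tiso taff] nE].
have [e be] : exists e : int -> nat, bijective e.
  apply: countably_infinite_bijection; last exact: (@infinite_setT_inj _ Posz (fun _ _ => @congr1 _ _ absz _ _)).
  exact: countableP.
pose sigma (x : wreath H) (k : int) := k + x.2.
pose A (x : wreath H) (k : int) (v : V) := tau (lamps_fun x.1 k) v.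
have AE x : (\esum_(k in [set: int]) (`|A x k 0| `^ p)%:E =
    (lamp_sum (fun h => n h `^ p) x.1)%:E)%E.
  have A0 k : (0 <= (`|A x k 0| `^ p)%:E)%E by rewrite lee_fin powR_ge0.
  set s := finsupp (x.1 : {fsfun int -> H with 1%g}).
  transitivity (\esum_(k in [set` s]) (`|A x k 0| `^ p)%:E)%E.
    rewrite [RHS]esum_mkcond; apply: eq_esum => k _; case: ifPn => //.
    rewrite notin_setE => /negP; rewrite mem_finsupp_lamps negbK => /eqP xk.
    by rewrite /A xk t1 normr0 powR0// gt_eqF.
  rewrite esum_fset//.
  rewrite fsbig_finite ?set_fsetK//=.
  by rewrite sumEFin /lamp_sum; under eq_bigr do rewrite -nE.
have [|||||||tau' [act tau'E]] := @lp_induced_action R V p p0 divV (wreath H) int e be sigma A.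
- by move=> k; rewrite /sigma addr0.
- by move=> x y k; rewrite /sigma wreath_mul2E; ring.
- by move=> k v; rewrite /A wreath1E1 t1.
- by move=> x y k v; rewrite /A wreath_mul1E tM.
- by move=> x k v w; rewrite /A tiso.
- by move=> x k r v w; rewrite /A taff.
- by move=> x; rewrite AE ltry.
exists (fun x => `|tau' x 0|); first by exists tau'.
by move=> x; apply: EFin_inj; rewrite tau'E AE.
Qed.

End LampSum.

(** * The action on half-line configurations and its coboundary *)

Section HalfLines.
Context (H : groupType).

(* The points are the configurations of lamps on a half-line [k, +oo[ , encoded
   as a pair of [k] and a lamp configuration that is trivial below [k]. *)
Definition trunc (k : int) (f : lamps H) : lamps H :=
  [fsfun j in finsupp (f : {fsfun int -> H with 1%g}) =>
    if k <= j then lamps_fun f j else 1%g].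

Lemma truncE k f j : lamps_fun (trunc k f) j = if k <= j then lamps_fun f j else 1%g.
Proof.
rewrite /lamps_fun /trunc fsfunE; case: ifPn => //.
by rewrite mem_finsupp negbK => /eqP ->; rewrite if_same.
Qed.

Definition halfline : Type :=
  {y : (int * lamps H)%type | trunc y.1 y.2 == y.2}.
HB.instance Definition _ := Choice.on halfline.

Lemma trunc_idem k f : trunc k (trunc k f) == trunc k f.
Proof. apply/eqP/lamps_ext => j; rewrite !truncE; case: (k <= j) => //. Qed.

Definition halfline_of (k : int) (f : lamps H) : halfline :=
  exist _ (k, trunc k f) (trunc_idem k f).

Lemma halflineP (y z : halfline) : (val y).1 = (val z).1 ->
  (forall j, (val y).1 <= j -> lamps_fun (val y).2 j = lamps_fun (val z).2 j) -> y = z.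
Proof.
case: y z => [[k f] kf] [[l g] lg] /= kl fg; subst l.
apply: val_inj; congr (_, _) => /=.
have <- : trunc k f = f by exact/eqP.
have <- : trunc k g = g by exact/eqP.
by apply: lamps_ext => j; rewrite !truncE; case: ifP => // /fg.
Qed.

(** Left multiplication on the cosets of the subgroup of all (g, 0) with g trivial on [0, +oo[ . *)
Definition halfline_act (x : wreath H) (y : halfline) : halfline :=
  halfline_of ((val y).1 + x.2) (x.1 * translate x.2 (val y).2)%g.

Lemma halfline_act1E x y : (val (halfline_act x y)).1 = (val y).1 + x.2.
Proof. by []. Qed.

Lemma halfline_act2E x y j : (val y).1 + x.2 <= j ->
  lamps_fun (val (halfline_act x y)).2 j =
    (lamps_fun x.1 j * lamps_fun (val y).2 (j - x.2))%g.
Proof. by move=> yj; rewrite /= truncE yj lamps_mulgE lamps_translateE. Qed.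

Lemma halfline_act1 y : halfline_act 1%g y = y.
Proof.
apply: halflineP; rewrite halfline_act1E addr0// => j yj.
rewrite halfline_act2E; last by rewrite addr0 in yj *.
by rewrite wreath1E1 mul1g -[(1%g : wreath H).2]/(0 : int) subr0.
Qed.

Lemma halfline_actM (x x' : wreath H) y :
  halfline_act (x * x')%g y = halfline_act x (halfline_act x' y).
Proof.
apply: halflineP; first by rewrite !halfline_act1E wreath_mul2E addrCA addrC addrAC.
move=> j; rewrite halfline_act1E wreath_mul2E => yj.
have yj' : (val y).1 + x'.2 + x.2 <= j by rewrite -addrA (addrC x'.2).
rewrite !halfline_act2E//; last by rewrite lerBrDr.
by rewrite wreath_mul1E -mulgA opprD addrA.
Qed.

Lemma countable_halfline : countable [set: wreath H] -> countable [set: halfline].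
Proof.
move=> /countable_injP[c cI]; apply/countable_injP.
exists (fun y : halfline => c ((val y).2, (val y).1)).
move=> [[k f] kf] [[l g] lg] _ _ /cI; rewrite !inE => /(_ I I)[fg kl].
by apply: val_inj => /=; congr (_, _).
Qed.

End HalfLines.

(** Reduces the summability of weight variations to single lamps at 0 and the unit shift. *)
Lemma wreath_ind (H : groupType) (Q : wreath H -> Prop) :
  Q 1%g -> (forall x y, Q x -> Q y -> Q (x * y)%g) -> (forall x, Q x -> Q x^-1%g) ->
  (forall h, Q (at0 h)) -> Q (shift H 1) -> forall x, Q x.
Proof.
move=> Q1 QM QV Qh Qs.
have Qn (n : nat) : Q (shift H n).
  elim: n => [|n IH]; first by rewrite shift0.
  by rewrite intS shiftD; exact: QM.
have Qm (m : int) : Q (shift H m).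
  case: m => n //; have -> : shift H (Negz n) = (shift H n.+1)^-1%g; last exact: QV.
  by apply: (@mulIg _ (shift H n.+1)); rewrite mulVg -shiftD NegzE addNr.
move=> [f m].
pose r := (\max_(k <- finsupp (f : {fsfun int -> H with 1%g})) `|k|%N)%N.
rewrite (@wreath_decomposition H f m r).
  apply: (QM) => //; apply: (QM) => //; apply: (big_ind Q) => // j _.
  exact: QM.
move=> k fk.
have := @leq_bigmax_seq _ (enum_fset (finsupp (f : {fsfun int -> H with 1%g}))) xpredT
  (fun k : int => absz k) k.
by apply => //; rewrite mem_finsupp.
Qed.

Section HalflineCocycle.
Context (R : realType) (H : groupType) (p delta : R).
Hypotheses (p1 : 1 <= p) (d0 : 0 < delta) (d1 : delta < 1).

Let p0 : 0 < p. Proof. exact: lt_le_trans p1. Qed.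

(* Chosen so that [slow_weight beta k] grows like [k `^ (delta - p^-1)] while its
   increments are p-summable. *)
Let beta := delta - p^-1 - 1.

Let pbeta : p * beta = - (p * (1 - delta)) - 1.
Proof. by rewrite /beta; field; rewrite gt_eqF. Qed.

(** Only half-lines with all lamps trivial and a positive starting point can carry weight. An
    element with a nontrivial lamp far to the right, or a large positive shift, therefore destroys
    the weight of many of them. *)
Definition halfline_weight (y : halfline H) : R :=
  if (val y).2 == 1%g then
    if (val y).1 is Posz k then slow_weight beta k else 0
  else 0.
Local Notation F := halfline_weight.

Lemma halfline_trivialP (y : halfline H) :
  reflect (forall j, (val y).1 <= j -> lamps_fun (val y).2 j = 1%g) ((val y).2 == 1%g).
Proof.
apply: (iffP eqP) => [-> j _|y1]; first exact: lamps1E.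
case: y y1 => [[k f] kf] /= y1; apply: lamps_ext => j.
have <- : trunc k f = f by exact/eqP.
by rewrite truncE lamps1E; case: ifP => // /y1.
Qed.

Lemma halfline_weight_le0 (y : halfline H) : (val y).1 <= 0 -> F y = 0.
Proof.
rewrite /halfline_weight; case: ifP => // _; case: (val y).1 => [[|k]|k] // _.
by rewrite /slow_weight big_nil.
Qed.

(** Starts at n + 1, as starting points up to 0 have weight 0. *)
Definition ray (n : nat) : halfline H := halfline_of n.+1 1%g.

Lemma ray1E n : (val (ray n)).1 = n.+1. Proof. by []. Qed.

Lemma ray2E n j : lamps_fun (val (ray n)).2 j = 1%g.
Proof. by rewrite /= truncE lamps1E if_same. Qed.

Lemma ray_inj : injective ray.
Proof. by move=> m n /(congr1 (fun y => (val y).1)) []. Qed.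

Lemma halfline_weight_ray n : F (ray n) = slow_weight beta n.+1.
Proof.
rewrite /halfline_weight ifT//; apply/halfline_trivialP => j _; exact: ray2E.
Qed.

Lemma not_rayP y : ~ range ray y -> (val y).1 <= 0 \/ (val y).2 != 1%g.
Proof.
move=> yr; have [y0|y0] := leP (val y).1 0; [by left|right].
apply/negP => /halfline_trivialP y1; apply: yr.
exists (absz (val y).1).-1 => //; apply: halflineP.
  by rewrite ray1E; case: ((val y).1) y0 => // -[].
by move=> j; rewrite ray1E => yj; rewrite ray2E y1//; case: ((val y).1) y0 yj => // -[].
Qed.

Definition weight_variation (x : wreath H) (y : halfline H) : R :=
  F (halfline_act x^-1%g y) - F y.
Local Notation D := weight_variation.

(** The quantified factor [c] absorbs the 2 of [powR_add_le], which makes the property stable under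
    products. *)
Let summable (x : wreath H) := forall c : R,
  (\esum_(y in [set: halfline H]) (`|c * D x y| `^ p)%:E < +oo)%E.

Let pow_ge0 (r : R) : (0 <= (r `^ p)%:E)%E. Proof. by rewrite lee_fin powR_ge0. Qed.

Let act_bij (x : wreath H) : bijective (halfline_act x).
Proof.
by exists (halfline_act x^-1%g) => y; rewrite -halfline_actM ?mulVg ?mulgV halfline_act1.
Qed.

Let reindex (x : wreath H) (a : halfline H -> \bar R) :
  (\esum_(y in [set: halfline H]) a (halfline_act x y) =
   \esum_(y in [set: halfline H]) a y)%E.
Proof. by rewrite -(reindex_esum setT setT (halfline_act x))// setTT_bijective. Qed.

Let summableM x y : summable x -> summable y -> summable (x * y)%g.
Proof.
move=> sx sy c; apply: (@le_lt_trans _ _ (\esum_(z in [set: halfline H])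
    ((`|2 * c * D x z| `^ p)%:E + (`|2 * c * D y (halfline_act x^-1%g z)| `^ p)%:E))%E).
  apply: le_esum => z _; rewrite -EFinD lee_fin -!(mulrA 2) !(normrM 2) (ger0_norm (ler0n _ 2)).
  apply: le_trans (powR_add_le (ltW p0) (normr_ge0 _) (normr_ge0 _)).
  rewrite ge0_ler_powR ?nnegrE ?(ltW p0) ?addr_ge0//.
  apply: le_trans (ler_normD _ _); rewrite -mulrDr.
  have -> : D (x * y)%g z = D x z + D y (halfline_act x^-1%g z); last by [].
  by rewrite /D invgM halfline_actM; ring.
rewrite esumD//; rewrite (reindex x^-1%g (fun z => (`|2 * c * D y z| `^ p)%:E)).
by apply: lte_add_pinfty; [exact: sx|exact: sy].
Qed.

Let summableV x : summable x -> summable x^-1%g.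
Proof.
move=> sx c; rewrite -(reindex x^-1%g).
rewrite (eq_esum (b := fun y => (`|c * D x y| `^ p)%:E)); first exact: sx.
move=> y _; rewrite /D invgK -halfline_actM mulgV halfline_act1.
by rewrite -(normrN (_ * _)) -mulrN opprB.
Qed.

Let summable0 x : (forall y, D x y = 0) -> summable x.
Proof.
move=> D0 c; rewrite esum1 ?ltry// => y _.
by rewrite D0 mulr0 normr0 powR0// gt_eqF.
Qed.

(** A lamp at 0 does not change half-lines starting after 0, and all others have weight 0 before and
    after; the cutoff in the weight is there for this. *)
Let summable_at0 h : summable (at0 h).
Proof.
apply: summable0 => y; rewrite /D.
have y1 : (val (halfline_act (at0 h)^-1%g y)).1 = (val y).1.
  by rewrite halfline_act1E wreath_inv2E oppr0 addr0.
have [y0|y0] := leP (val y).1 0.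
  by rewrite !halfline_weight_le0 ?subrr// y1.
suff -> : halfline_act (at0 h)^-1%g y = y by rewrite subrr.
apply: halflineP => // j; rewrite y1 => yj.
rewrite halfline_act2E; last by rewrite -halfline_act1E y1.
rewrite wreath_inv1E wreath_inv2E -[(at0 h).2]/(0 : int) oppr0 !addr0 lampE ifF ?invg1 ?mul1g//.
by apply/negbTE; rewrite gt_eqF// (lt_le_trans y0).
Qed.

(** A shift by 1 changes the weight of [ray n] by the single term (n + 1)^beta of [slow_weight]; the
    p-th powers converge because p beta = - eta - 1 with eta > 0. *)
Let summable_shift : summable (shift H 1).
Proof.
move=> c.
have inv1 j : lamps_fun (shift H 1)^-1%g.1 j = 1%g.
  by rewrite wreath_inv1E lamps1E invg1.
have triv y : ((val (halfline_act (shift H 1)^-1%g y)).2 == 1%g) = ((val y).2 == 1%g).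
  apply/halfline_trivialP/halfline_trivialP => y1 j yj.
    have := y1 (j - 1); rewrite halfline_act1E wreath_inv2E => /(_ (lerB yj (lexx _))).
    by rewrite halfline_act2E ?lerB// inv1 mul1g wreath_inv2E /= opprK subrK.
  rewrite halfline_act2E; last exact: yj.
  by rewrite inv1 mul1g y1// wreath_inv2E opprK -lerBlDr.
have D0 y : ~ range ray y -> D (shift H 1) y = 0.
  move=> /not_rayP[y0|y1]; rewrite /D.
    have y0' : (val (halfline_act (shift H 1)^-1%g y)).1 <= 0.
      by rewrite halfline_act1E wreath_inv2E (le_trans _ y0)// gerDl oppr_le0.
    by rewrite !halfline_weight_le0 ?subrr.
  by rewrite /halfline_weight triv (negPf y1) subrr.
have Dray n : D (shift H 1) (ray n) = - n.+1%:R `^ beta.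
  rewrite /D halfline_weight_ray /halfline_weight triv ifT; last first.
    by apply/halfline_trivialP => j _; exact: ray2E.
  by rewrite subn1 /slow_weight big_nat_recr//= opprD addrA subrr sub0r.
rewrite (esum_range ray_inj)//; last first.
  by move=> y /D0 ->; rewrite mulr0 normr0 powR0// gt_eqF.
set eta := p * (1 - delta); have e0 : 0 < eta by rewrite mulr_gt0// subr_gt0.
apply: (@le_lt_trans _ _ (`|c| `^ p * (1 + eta^-1))%:E); last exact: ltry.
apply: lime_le; first by apply: is_cvg_nneseries => n _ _.
apply: nearW => n; rewrite sumEFin lee_fin.
rewrite (eq_bigr (fun j => `|c| `^ p * j.+1%:R `^ (- eta - 1))); last first.
  move=> j _; rewrite Dray normrM normrN (ger0_norm (powR_ge0 _ _)) powRM ?powR_ge0//.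
  by rewrite -powRrM (mulrC beta) pbeta.
by rewrite -mulr_sumr ler_wpM2l ?powR_ge0// pseries_le.
Qed.

Lemma weight_variation_summable x :
  (\esum_(y in [set: halfline H]) (`|D x y| `^ p)%:E < +oo)%E.
Proof.
have := @wreath_ind H summable _ summableM summableV summable_at0 summable_shift x.
move=> h; have /h/(_ 1) : summable 1%g.
  by apply: summable0 => y; rewrite /D invg1 halfline_act1 subrr.
by under eq_esum do rewrite mul1r.
Qed.

(** For n < K, acting by x^-1 either moves [ray n] to a starting point at most 0 or puts a
    nontrivial lamp on it. Each of these K rays loses its whole weight, and p beta + p + 1 = delta
    p. *)
Lemma weight_variation_ge (x : wreath H) (K : nat) : (0 < K)%N ->
  K%:Z <= x.2 \/ (exists2 k, K%:Z <= k & lamps_fun x.1 k != 1%g) ->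
  ((2^-1 `^ (p + 1) * (K%:R `^ delta) `^ p)%:E <=
   \esum_(y in [set: halfline H]) (`|D x y| `^ p)%:E)%E.
Proof.
move=> K0 xK.
have b0 : beta <= 0.
  have pi : 0 < p^-1 by rewrite invr_gt0.
  by rewrite /beta -addrA -opprD subr_le0 ltW// (lt_trans d1)// ltrDr.
apply: le_trans (esum_ge_series ray_inj K _) => //.
rewrite sumEFin lee_fin -powRrM.
have -> : delta * p = p * beta + p + 1 by rewrite pbeta; ring.
apply: le_trans (slow_weight_sum p1 b0 K0) _.
rewrite big_nat [leRHS]big_nat; apply: ler_sum => n /andP[_ nK].
suff -> : D x (ray n) = - slow_weight beta n.+1.
  by rewrite normrN ger0_norm//; apply: sumr_ge0 => j _; exact: powR_ge0.
rewrite /D halfline_weight_ray; suff -> : F (halfline_act x^-1%g (ray n)) = 0.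
  by rewrite add0r.
case: xK => [xK|[k Kk xk]].
  rewrite halfline_weight_le0// halfline_act1E wreath_inv2E ray1E subr_le0.
  by rewrite (le_trans _ xK)// lez_nat.
rewrite /halfline_weight; case: ifP => // /halfline_trivialP/(_ (k - x.2)).
rewrite halfline_act1E wreath_inv2E ray1E lerB// ?(le_trans _ Kk)// => /(_ isT).
rewrite halfline_act2E; last by rewrite wreath_inv2E lerB// (le_trans _ Kk).
rewrite ray2E mulg1 wreath_inv1E subrK => /(congr1 (fun h => h^-1%g)).
by rewrite invgK invg1 => /eqP; rewrite (negPf xk).
Qed.

End HalflineCocycle.

Lemma powR_le_inj (R : realType) (p : R) : 0 < p ->
  forall x y : R, 0 <= x -> 0 <= y -> x `^ p <= y `^ p -> x <= y.
Proof.
move=> p0 x y x0 y0; apply: contraTT; rewrite -!ltNge => yx.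
by rewrite gt0_ltr_powR// nnegrE.
Qed.

(** For s <= 1 the power is subadditive. For s > 1 this is the power mean inequality up to a
    constant: with [B] half the mean, a^s >= B^(s - 1) (a - B) for every term a, and subtracting [B]
    from all terms removes only half of the sum. *)
Lemma sum_powR_ge (R : realType) (I : Type) (r : seq I) (a : I -> R) (s : R) :
  0 < s -> (forall i, 0 <= a i) -> (0 < size r)%N ->
  2^-1 `^ s * (size r)%:R `^ (- Num.max 0 (s - 1)) * (\sum_(i <- r) a i) `^ s <=
  \sum_(i <- r) a i `^ s.
Proof.
move=> s0 a0 r0; set A := \sum_(i <- r) a i.
have A0 : 0 <= A by exact: sumr_ge0.
have m0 : 0 < (size r)%:R :> R by rewrite ltr0n.
have [s1|s1] := leP s 1.
  have -> : Num.max 0 (s - 1) = 0 by apply/max_idPl; lra.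
  rewrite oppr0 powRr0 mulr1.
  have add2 x y : 0 <= x -> 0 <= y -> (x + y) `^ s <= x `^ s + y `^ s.
    move=> x0 y0; have [xy|xy] := leP (x + y) 0.
      have -> : x = 0 by lra.
      have -> : y = 0 by lra.
      by rewrite addr0 lerDl powR_ge0.
    have s01 : 0 < s <= 1 by rewrite s0.
    have := @powR_concave_chord R s 0 x (x + y) s01 (lexx _).
    have := @powR_concave_chord R s 0 y (x + y) s01 (lexx _).
    rewrite powR0 ?gt_eqF// !mulr0 !add0r !subr0 => hy hx.
    have {}hx : x * (x + y) `^ s <= (x + y) * x `^ s by apply: hx; lra.
    have {}hy : y * (x + y) `^ s <= (x + y) * y `^ s by apply: hy; lra.
    by rewrite -(ler_pM2l xy); lra.
  have sub : A `^ s <= \sum_(i <- r) a i `^ s.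
    rewrite /A; elim: (r) => [|i l IH]; first by rewrite !big_nil powR0// gt_eqF.
    rewrite !big_cons (le_trans (add2 _ _ _ _))// ?sumr_ge0//.
    by rewrite lerD2l.
  apply: le_trans sub; rewrite ler_piMl ?powR_ge0//.
  apply: (@le_trans _ _ (1 `^ s)); last by rewrite powR1.
  by rewrite ge0_ler_powR ?nnegrE//; lra.
have -> : Num.max 0 (s - 1) = s - 1 by apply/max_idPr; lra.
pose B := A / (2 * (size r)%:R).
have B0 : 0 <= B by rewrite divr_ge0// mulr_ge0// ltW.
have h i : B `^ (s - 1) * (a i - B) <= a i `^ s.
  have [aB|Ba] := leP (a i) B.
    by rewrite (le_trans _ (powR_ge0 _ _))// mulr_ge0_le0 ?powR_ge0// subr_le0.
  have ai0 : 0 < a i by exact: le_lt_trans Ba.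
  have -> : a i `^ s = a i `^ (s - 1) * a i.
    by rewrite -{3}(powRr1 (ltW ai0)) -powRD_gt0// subrK.
  rewrite ler_pM ?powR_ge0//; [lra| |lra].
  by rewrite ge0_ler_powR ?nnegrE//; lra.
apply: (@le_trans _ _ (\sum_(i <- r) B `^ (s - 1) * (a i - B))); last exact: ler_sum.
rewrite -mulr_sumr sumrB big_const_seq count_predT iter_addr_0 -/A -(mulr_natr B).
have -> : A - B * (size r)%:R = A / 2.
  by rewrite /B; field; rewrite gt_eqF.
rewrite /B powRM ?invr_ge0 ?mulr_ge0 ?(ltW m0)//.
have inv2 : (2 * (size r)%:R)^-1 `^ (s - 1) = 2^-1 `^ (s - 1) * (size r)%:R `^ (- (s - 1)).
  by rewrite invfM powRM ?invr_ge0 ?(ltW m0)// -(powR_inv1 (ltW m0)) -powRrM mulN1r.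
rewrite inv2.
have -> : 2^-1 `^ s = 2^-1 `^ (s - 1) * (2^-1 : R).
  by rewrite -{3}(@powRr1 _ 2^-1)// -powRD_gt0// subrK.
have [->|An0] := eqVneq A 0.
  by rewrite powR0 ?gt_eqF// !mulr0 mul0r mulr0.
have {An0} Ap : 0 < A by rewrite lt_neqAle eq_sym An0.
have -> : A `^ s = A `^ (s - 1) * A by rewrite -{3}(@powRr1 _ A)// -powRD_gt0// subrK.
by rewrite le_eqVlt; apply/orP; left; apply/eqP; ring.
Qed.

Section Reflection.
Context (H : groupType).
Implicit Types (x y : wreath H).

Definition reflect_lamps (f : lamps H) : lamps H :=
  [fsfun k in [fset (- j)%R | j in finsupp (f : {fsfun int -> H with 1%g})]%fset =>
    lamps_fun f (- k)].

Lemma reflect_lampsE f k : lamps_fun (reflect_lamps f) k = lamps_fun f (- k).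
Proof.
rewrite /lamps_fun /reflect_lamps fsfunE; case: ifPn => // kf.
apply/esym/eqP; rewrite -[_ == _]negbK -mem_finsupp_lamps.
apply: contra kf => kf; apply/imfsetP; exists (- k) => //.
by rewrite opprK.
Qed.

(** The automorphism induced by k -> -k. Half-lines towards +oo detect only the positive side;
    pulling back along it covers the negative side. *)
Definition reflection x : wreath H := (reflect_lamps x.1, - x.2).

Lemma reflection1 : reflection 1%g = 1%g.
Proof.
by apply: wreathP => [k|]; [rewrite /= reflect_lampsE !wreath1E1|exact: oppr0].
Qed.

Lemma reflectionM : {morph reflection : x y / (x * y)%g}.
Proof.
move=> x y; apply: wreathP => [k|]; last exact: opprD.
rewrite wreath_mul1E /= !reflect_lampsE wreath_mul1E.
by congr (_ * lamps_fun _ _)%g; rewrite opprK opprD.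
Qed.

End Reflection.

Section RangeDisplacement.
Context (R : realType) (V : normedModType R) (p delta : R) (H : groupType).
Hypotheses (p1 : 1 <= p) (divV : lp_divisible V p) (unitV : exists e : V, `|e| = 1).
Hypotheses (d0 : 0 < delta) (d1 : delta < 1) (cW : countable [set: wreath H]).

Let p0 : 0 < p. Proof. exact: lt_le_trans p1. Qed.

Lemma displacement_right : exists2 n : wreath H -> R, displacement V n &
  exists2 c : R, 0 < c & forall x (K : nat), (0 < K)%N ->
    K%:Z <= x.2 \/ (exists2 k, K%:Z <= k & lamps_fun x.1 k != 1%g) ->
    c * K%:R `^ delta <= n x.
Proof.
have [v v1] := unitV.
have [e be] : exists e : halfline H -> nat, bijective e.
  apply: countably_infinite_bijection; first exact: countable_halfline.
  exact: infinite_setT_inj (@ray_inj H).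
have [|n dn nE] := displacement_coboundary (p := p) (G := wreath H) (e := e)
  (sigma := @halfline_act H) (F := halfline_weight p delta) p0 divV v1 be (@halfline_act1 H) (@halfline_actM H).
  by move=> x; exact: weight_variation_summable.
exists n => //; exists ((2^-1 `^ (p + 1)) `^ p^-1); first by rewrite !powR_gt0.
move=> x K K0 xK; apply: (powR_le_inj p0).
- by rewrite mulr_ge0 ?powR_ge0.
- exact: displacement_ge0 dn.
rewrite powRM ?powR_ge0// -[_ `^ p^-1 `^ p]powRrM mulVf ?gt_eqF// powRr1 ?powR_ge0//.
by rewrite -lee_fin nE; exact: weight_variation_ge.
Qed.

Lemma displacement_range : exists2 n : wreath H -> R, displacement V n &
  exists2 c : R, 0 < c & forall x (r : nat), (0 < r)%N ->
    (r <= `|x.2|)%N \/ (exists2 k, (r <= `|k|)%N & lamps_fun x.1 k != 1%g) ->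
    c * r%:R `^ delta <= n x.
Proof.
have [n dn [c c0 nc]] := displacement_right.
have dn' := displacement_comp (@reflection1 H) (@reflectionM H) dn.
have [N dN NE] := displacement_lp_sum2 p0 divV dn dn'.
exists N => //; exists c => // x r r0 xr.
have N1 : n x <= N x.
  apply: (powR_le_inj p0); rewrite ?(displacement_ge0 _ dn) ?(displacement_ge0 _ dN)//.
  by rewrite NE lerDl powR_ge0.
have N2 : n (reflection x) <= N x.
  apply: (powR_le_inj p0); rewrite ?(displacement_ge0 _ dn) ?(displacement_ge0 _ dN)//.
  by rewrite NE lerDr powR_ge0.
have pos : r%:Z <= x.2 \/ (exists2 k, r%:Z <= k & lamps_fun x.1 k != 1%g) ->
    c * r%:R `^ delta <= N x.
  by move=> h; apply: le_trans N1; exact: nc.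
have neg : r%:Z <= - x.2 \/ (exists2 k, r%:Z <= - k & lamps_fun x.1 k != 1%g) ->
    c * r%:R `^ delta <= N x.
  move=> h; apply: le_trans N2; apply: nc => //; case: h => [|[k rk xk]]; first by left.
  by right; exists (- k) => //; rewrite reflect_lampsE opprK.
case: xr => [xr|[k rk xk]].
  have [x0|x0] := leP 0 x.2; first by apply: pos; left; lia.
  by apply: neg; left; lia.
have [k0|k0] := leP 0 k; first by apply: pos; right; exists k => //; lia.
by apply: neg; right; exists k => //; lia.
Qed.

End RangeDisplacement.

(** The least radius is taken, so that it is attained when positive, as [displacement_range]
    requires. *)
Lemma wreath_range (H : groupType) (x : wreath H) : exists r : nat,
  [/\ forall k, lamps_fun x.1 k != 1%g -> (`|k| <= r)%N, (`|x.2| <= r)%N &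
      (0 < r)%N -> (r <= `|x.2|)%N \/
        exists2 k, (r <= `|k|)%N & lamps_fun x.1 k != 1%g].
Proof.
pose Q (r : nat) := (forall k, lamps_fun x.1 k != 1%g -> (`|k| <= r)%N) /\ (`|x.2| <= r)%N.
have exQ : exists r, `[< Q r >].
  pose s := enum_fset (finsupp (x.1 : {fsfun int -> H with 1%g})).
  exists (maxn (\max_(k <- s) `|k|%N) `|x.2|); apply/asboolP; split; last exact: leq_maxr.
  move=> k xk; rewrite (leq_trans _ (leq_maxl _ _))//.
  have := @leq_bigmax_seq _ s xpredT (fun k : int => absz k) k.
  by apply => //; rewrite mem_finsupp.
case: (ex_minnP exQ) => r /asboolP[Q1 Q2] rmin; exists r; split => // r0.
apply: contrapT => /not_orP[/negP]; rewrite -ltnNge => xr nk.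
suff /rmin : `[< Q r.-1 >] by rewrite -ltnS prednK// ltnn.
apply/asboolP; split; last by rewrite -ltnS prednK.
move=> k xk; rewrite -ltnS prednK// ltnNge; apply/negP => rk.
by apply: nk; exists k.
Qed.

(** Here [M] stands for a normalised displacement. Eliminating r through r <= M^(1/delta) gives
    S^beta <= M^(1 + t/delta), and the condition on [alpha] says exactly that the resulting exponent
    of [M] is at most 1. *)
Lemma growth_interpolation (R : realType) (S r M alpha beta delta t : R) :
  0 <= S -> 1 <= r -> 1 <= M -> 0 < delta -> 0 < beta -> 0 <= t ->
  0 <= alpha -> alpha <= delta -> alpha * (1 + t / delta) <= beta ->
  r `^ delta <= M -> S `^ beta <= M * r `^ t -> S `^ alpha <= M /\ r `^ alpha <= M.
Proof.
move=> S0 r1 M1 d0 b0 t0 a0 ad ab rM SM.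
have M0 : 0 <= M by lra.
have pow x e : 0 <= x -> 0 <= e -> x <= M -> x `^ e <= M `^ e.
  by move=> x0 e0 xM; rewrite ge0_ler_powR ?nnegrE.
have Mle e : e <= 1 -> M `^ e <= M.
  by move=> e1; rewrite -[leRHS](powRr1 M0) ler_powR.
have rE e : r `^ e = (r `^ delta) `^ (e / delta).
  by rewrite -powRrM mulrCA mulfV ?mulr1// gt_eqF.
have rt : r `^ t <= M `^ (t / delta).
  by rewrite rE pow ?powR_ge0// divr_ge0// ltW.
split; last first.
  by rewrite rE (le_trans (pow _ _ _ _ rM)) ?powR_ge0 ?divr_ge0 ?(ltW d0)// Mle// ler_pdivrMr// mul1r.
have -> : S `^ alpha = (S `^ beta) `^ (alpha / beta).
  by rewrite -powRrM mulrCA mulfV ?mulr1// gt_eqF.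
apply: (@le_trans _ _ ((M `^ (1 + t / delta)) `^ (alpha / beta))).
  rewrite ge0_ler_powR ?nnegrE ?powR_ge0 ?divr_ge0 ?(ltW b0)//.
  apply: le_trans SM _; rewrite powRD_gt0 ?powRr1//; last lra.
  by rewrite ler_wpM2l.
rewrite -powRrM Mle// mulrA ler_pdivrMr// mul1r mulrC.
by rewrite mulrC (mulrC _ alpha).
Qed.

(** * The lower bound: the lamp sum joined with the range cocycle *)

Section WreathAdmissible.
Context (R : realType) (V : normedModType R) (p : R) (H : groupType).
Hypotheses (p1 : 1 <= p) (divV : lp_divisible V p) (unitV : exists e : V, `|e| = 1).
Context (S : seq H) (genS : generates S).
Context (S' : seq (wreath H)) (genS' : generates S').
Local Notation len h := ((word_length genS h)%:R : R).

Let p0 : 0 < p. Proof. exact: lt_le_trans p1. Qed.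

(** [sum_powR_ge] with exponent beta p over the 2 r + 1 <= 3 r positions; the p-th root of its loss
    is the power [t] of 3 r. *)
Lemma lamp_sum_powR_ge (n : H -> R) (c beta t : R) (f : lamps H) (r : nat) :
  t = Num.max 0 (beta - p^-1) ->
  0 < c -> 0 < beta -> (forall h, (0 < word_length genS h)%N -> c * len h `^ beta <= n h) ->
  n 1%g = 0 -> (forall h, 0 <= n h) -> (0 < r)%N ->
  (forall k, lamps_fun f k != 1%g -> (`|k| <= r)%N) ->
  (c * 2^-1 `^ beta * 3 `^ (- t) * r%:R `^ (- t) * (lamp_sum (fun h => len h) f) `^ beta) `^ p
  <= lamp_sum (fun h => n h `^ p) f.
Proof.
move=> tE c0 b0 nc n1 n0 r0 fr.
pose s := [seq (j%:Z - r%:Z) | j <- iota 0 r.*2.+1].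
have us : uniq s by rewrite map_inj_uniq ?iota_uniq// => i j /addIr [].
have fs k : lamps_fun f k != 1%g -> k \in s.
  move=> /fr kr; apply/mapP; exists (absz (k + r%:Z)); last by lia.
  by rewrite mem_iota; lia.
have ss : size s = r.*2.+1 by rewrite size_map size_iota.
have len1 : len 1%g = 0 by rewrite word_length1.
have np1 : n 1%g `^ p = 0 by rewrite n1 powR0// gt_eqF.
rewrite (lamp_sumE (N := fun h => len h) len1 us fs).
rewrite (lamp_sumE (N := fun h => n h `^ p) np1 us fs).
have s0 : 0 < beta * p by rewrite mulr_gt0.
set L := \sum_(k <- s) _; have L0 : 0 <= L by apply: sumr_ge0.
have h : 2^-1 `^ (beta * p) * r.*2.+1%:R `^ (- Num.max 0 (beta * p - 1)) * L `^ (beta * p) <=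
    \sum_(k <- s) len (lamps_fun f k) `^ (beta * p).
  by rewrite -ss; apply: sum_powR_ge; rewrite ?ss.
have tp : Num.max 0 (beta * p - 1) = t * p.
  rewrite tE maxr_pMl ?(ltW p0)// mul0r mulrBl mulVf// gt_eqF//.
have t0 : 0 <= t by rewrite tE le_max lexx.
have pw x e : 0 <= x -> (x `^ e) `^ p = x `^ (e * p) by move=> ?; rewrite -powRrM.
apply: (@le_trans _ _ (c `^ p * (2^-1 `^ (beta * p) * r.*2.+1%:R `^ (- Num.max 0 (beta * p - 1)) * L `^ (beta * p)))).
  rewrite tp !powRM ?mulr_ge0 ?powR_ge0 ?(ltW c0)// ?pw// !mulNr -!mulrA.
  rewrite !ler_wpM2l ?powR_ge0// mulrA ler_wpM2r ?powR_ge0// -powRM//.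
  rewrite !powRN lef_pV2 ?posrE ?powR_gt0 ?mulr_gt0 ?ltr0n//.
  rewrite ge0_ler_powR ?nnegrE ?mulr_ge0 ?(ltW p0)//.
  by rewrite -(natrM _ 3) ler_nat; lia.
apply: le_trans (ler_wpM2l (powR_ge0 _ _) h) _.
rewrite mulr_sumr; apply: ler_sum => k _.
have [len0|len0] := posnP (word_length genS (lamps_fun f k)).
  by rewrite len0 powR0 ?gt_eqF// mulr0 powR_ge0.
rewrite -pw// -powRM ?powR_ge0 ?(ltW c0)// ge0_ler_powR ?nnegrE ?mulr_ge0 ?powR_ge0 ?(ltW p0) ?(ltW c0)//.
exact: nc.
Qed.

Lemma wreath_admissible (alpha beta delta : R) : 0 < delta -> delta < 1 ->
  0 < beta -> 0 <= alpha -> alpha <= delta ->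
  alpha * (1 + Num.max 0 (beta - p^-1) / delta) <= beta ->
  admissible V genS beta -> admissible V genS' alpha.
Proof.
move=> d0 d1 b0 a0 ad; set t := Num.max 0 (beta - p^-1) => ab.
have t0 : 0 <= t by rewrite /t le_max lexx.
move=> [n dn [c c0 nc]].
have [n1 dn1 n1E] := displacement_lamp_sum p0 divV dn.
have [n2 dn2 [c2 c20 n2c]] := displacement_range p1 divV unitV d0 d1 (fin_gen_countable genS').
have [N dN NE] := displacement_lp_sum2 p0 divV dn1 dn2.
have N1 x : n1 x <= N x.
  apply: (powR_le_inj p0); rewrite ?(displacement_ge0 _ dn1) ?(displacement_ge0 _ dN)//.
  by rewrite NE lerDl powR_ge0.
have N2 x : n2 x <= N x.
  apply: (powR_le_inj p0); rewrite ?(displacement_ge0 _ dn2) ?(displacement_ge0 _ dN)//.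
  by rewrite NE lerDr powR_ge0.
pose c1 := c * 2^-1 `^ beta * 3 `^ (- t).
have c10 : 0 < c1 by rewrite !mulr_gt0 ?powR_gt0.
pose m := Num.min c1 c2; have m0 : 0 < m by rewrite lt_min c10.
have [C C0 lenC] := length_le_lamp_sum R genS genS'.
(* The 3 comes from 1 + T + r <= 3 max(T, r), valid as r >= 1. *)
exists N => //; exists (m / (3 * C) `^ alpha).
  by rewrite divr_gt0// powR_gt0// mulr_gt0.
move=> x x0; have [rho [xrho mrho rhoP]] := wreath_range x.
pose r := maxn 1 rho; have r0 : (0 < r)%N by rewrite leq_maxl.
have xr k : lamps_fun x.1 k != 1%g -> (`|k| <= r)%N.
  by move=> /xrho /leq_trans; apply; exact: leq_maxr.
set T := lamp_sum (fun h => len h) x.1.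
have T0 : 0 <= T by apply: lamp_sum_ge0 => h; exact: ler0n.
have r1 : 1 <= r%:R :> R by rewrite ler1n.
have r0' : 0 < r%:R :> R by rewrite ltr0n.
have hT : T `^ beta <= N x / m * r%:R `^ t.
  have : c1 * r%:R `^ (- t) * T `^ beta <= N x.
    apply: le_trans (N1 x); apply: (powR_le_inj p0).
    - by rewrite !mulr_ge0 ?powR_ge0// ltW.
    - exact: displacement_ge0 dn1.
    rewrite n1E; apply: lamp_sum_powR_ge => //; first exact: displacement1 dn.
    by move=> h; exact: displacement_ge0 dn.
  have mc1 : m <= c1 by rewrite ge_min lexx.
  move=> h; rewrite mulrAC ler_pdivlMr// -ler_pdivrMr ?powR_gt0// -powRN.
  apply: le_trans h.
  have -> : T `^ beta * m * r%:R `^ (- t) = m * r%:R `^ (- t) * T `^ beta by ring.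
  by rewrite !ler_wpM2r ?powR_ge0.
have hr : r%:R `^ delta <= N x / m.
  rewrite ler_pdivlMr// mulrC; have mc2 : m <= c2 by rewrite ge_min lexx orbT.
  have [rho0|rho0] := posnP rho; last first.
    have -> : r = rho by apply/maxn_idPr.
    apply: le_trans (N2 x); apply: le_trans (n2c x rho rho0 (rhoP rho0)).
    by rewrite ler_wpM2r ?powR_ge0.
  (* At radius 0 the range cocycle gives nothing. But x is then a single lamp at 0, nontrivial since
     x is not 1, so T >= 1 and [hT] suffices. *)
  have rE : r = 1%N by rewrite /r rho0.
  move: hT; rewrite rE !powR1 !mulr1 ler_pdivlMr// => hT.
  apply: le_trans hT; rewrite -[leLHS]mul1r ler_wpM2r ?(ltW m0)//.
  apply: (@le_trans _ _ (1 `^ beta)); first by rewrite powR1.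
  rewrite ge0_ler_powR ?nnegrE ?(ltW b0)//.
  have x2 : x.2 = 0 by move: mrho; rewrite rho0 leqn0 absz_eq0 => /eqP.
  have xk k : lamps_fun x.1 k != 1%g -> k = 0.
    by move=> /xrho; rewrite rho0 leqn0 absz_eq0 => /eqP.
  have -> : T = len (lamps_fun x.1 0).
    rewrite /T (lamp_sumE (s := [:: 0])) ?word_length1 ?big_seq1//.
    by move=> k /xk ->; rewrite mem_head.
  rewrite ler1n lt0n; apply: contraTN x0 => /eqP/word_length_eq0 x01.
  suff -> : x = 1%g by rewrite word_length1.
  apply: wreathP => // k; rewrite wreath1E1.
  by apply/eqP/negPn/negP => /[dup] /xk ->; rewrite x01 eqxx.
have M1 : 1 <= N x / m.
  apply: le_trans hr; apply: (@le_trans _ _ (1 `^ delta)); first by rewrite powR1.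
  by rewrite ge0_ler_powR ?nnegrE ?(ltW d0)//; lra.
have [Ta ra] := growth_interpolation T0 r1 M1 d0 b0 t0 a0 ad ab hr hT.
rewrite mulrAC ler_pdivrMr ?powR_gt0 ?mulr_gt0//.
rewrite mulrC -ler_pdivlMr//.
have mr : (`|x.2| <= r)%N by rewrite (leq_trans mrho)// leq_maxr.
have := lenC x.1 x.2 r xr mr; rewrite -/T -surjective_pairing => lx.
have {}lx : (word_length genS' x)%:R <= 3 * C * Num.max T r%:R.
  apply: le_trans lx _; rewrite -mulrA mulrCA ler_pM2l//.
  have : T <= Num.max T r%:R by rewrite le_max lexx.
  have : r%:R <= Num.max T r%:R by rewrite le_max lexx orbT.
  lra.
apply: (@le_trans _ _ ((3 * C * Num.max T r%:R) `^ alpha)).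
  by rewrite ge0_ler_powR ?nnegrE// (le_trans _ lx).
rewrite powRM ?mulr_ge0 ?(ltW C0)//; last by rewrite le_max T0.
rewrite -[leRHS]mulrAC mulrC ler_wpM2r ?powR_ge0//.
by case: (leP T r%:R).
Qed.

End WreathAdmissible.

(** * The upper bound *)

Section Restriction.
Context (R : realType) (V : normedModType R) (H : groupType).
Context (S : seq H) (genS : generates S).
Context (S' : seq (wreath H)) (genS' : generates S').
Local Notation len h := ((word_length genS h)%:R : R).
Local Notation len' x := ((word_length genS' x)%:R : R).

Lemma lamp_sum_at0 h : lamp_sum (fun h => len h) (at0 h).1 = len h.
Proof.
have hs k : lamps_fun (at0 h).1 k != 1%g -> k \in [:: 0].
  by rewrite lampE inE; case: (k == 0) => //; rewrite eqxx.
have len1 : len 1%g = 0 by rewrite word_length1.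
by rewrite (lamp_sumE (N := fun h => len h) len1 _ hs)// big_seq1 lampE eqxx.
Qed.

Lemma length_at0_gt0 h : (0 < word_length genS h)%N -> (0 < word_length genS' (at0 h))%N.
Proof.
rewrite !lt0n; apply: contraNN => /eqP/word_length_eq0 /(congr1 (fun x => lamps_fun x.1 0)).
by rewrite wreath1E1 lampE eqxx => ->; rewrite word_length1.
Qed.

(** [lamp_sum_le_length] shows that [at0] shortens lengths by at most a constant factor. *)
Lemma admissible_restrict alpha : 0 <= alpha ->
  admissible V genS' alpha -> admissible V genS alpha.
Proof.
move=> a0 [n dn [c c0 nc]].
have [L L0 Llen] := lamp_sum_le_length R genS genS'.
exists (n \o @at0 H); first exact: displacement_comp (at01 H) (@at0M H) dn.
exists (c / L `^ alpha); first by rewrite divr_gt0// powR_gt0.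
move=> h h0; apply: le_trans (nc _ (length_at0_gt0 h0)).
rewrite mulrAC -mulrA ler_pM2l// ler_pdivrMr ?powR_gt0// mulrC -powRM ?(ltW L0)//.
rewrite ge0_ler_powR ?nnegrE ?mulr_ge0 ?(ltW L0)//.
by rewrite -lamp_sum_at0; exact: Llen.
Qed.

End Restriction.

Section Roundness.
Context (R : realType) (V : normedModType R) (p : R).
Hypothesis p1 : 1 < p.
Hypothesis roundV : has_roundness V p.

Let p0 : 0 < p. Proof. exact: lt_trans p1. Qed.

(** Roundness for the quadrilateral 0, x 0, g x 0, g 0; commutation makes its opposite sides equal
    in length. *)
Lemma displacement_roundness (G : groupType) (n : G -> R) (g x : G) :
  displacement V n -> (g * x = x * g)%g ->
  n (g * x)%g `^ p + n (g * x^-1)%g `^ p <= 2 * (n g `^ p + n x `^ p).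
Proof.
move=> dn gx; have [tau [act nE]] := dn; have [t1 tM tiso taff] := act.
have gx' : (g * x^-1 = x^-1 * g)%g.
  by apply: (@mulIg _ x); rewrite -mulgA mulVg mulg1 -mulgA gx mulgA mulVg mul1g.
have := roundV 0 (tau x 0) (tau g (tau x 0)) (tau g 0).
have -> : `|0 - tau g (tau x 0)| = n (g * x)%g by rewrite sub0r normrN -tM nE.
have -> : `|tau x 0 - tau g 0| = n (g * x^-1)%g.
  by rewrite (displacement_dist _ _ _ act) subr0 -gx' nE.
have -> : `|0 - tau x 0| = n x by rewrite sub0r normrN nE.
have -> : `|tau x 0 - tau g (tau x 0)| = n g.
  by rewrite -tM gx tM tiso sub0r normrN nE.
have -> : `|tau g (tau x 0) - tau g 0| = n x by rewrite tiso subr0 nE.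
have -> : `|tau g 0 - 0| = n g by rewrite subr0 nE.
lra.
Qed.

(** Minkowski's inequality for (B, B) + (0, u) in the plane with its l_p norm, read off from
    supermodularity at (z - 1) B, B, u. *)
Lemma powR_minkowski2 (B u : R) : 0 <= B -> 0 <= u ->
  B `^ p + (B + u) `^ p <= (2 `^ p^-1 * B + u) `^ p.
Proof.
move=> B0 u0; set z := 2 `^ p^-1.
have z1 : 1 <= z.
  apply: (@le_trans _ _ (1 `^ p^-1)); first by rewrite powR1.
  by rewrite ge0_ler_powR ?nnegrE ?invr_ge0 ?(ltW p0)//; lra.
have zp : (z * B) `^ p = 2 * B `^ p.
  by rewrite powRM ?powR_ge0// -powRrM mulVf ?gt_eqF// powRr1.
have zB0 : 0 <= (z - 1) * B by rewrite mulr_ge0// subr_ge0.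
have := powR_supermodular (ltW p1) zB0 B0 u0.
have -> : (z - 1) * B + B = z * B by ring.
rewrite zp; lra.
Qed.

Section SpreadElements.
Context (H : groupType) (n : wreath H -> R).
Hypothesis dn : displacement V n.
Context (S : seq H) (genS : generates S).
Local Notation len h := ((word_length genS h)%:R : R).

(** Solves 2 D = 2^(1/p) D + 2 n(shift), the balance that lets the linear term survive one
    doubling. *)
Let D := 2 * n (shift H 1) / (2 - 2 `^ p^-1).

Let z2 : 2 `^ p^-1 < 2 :> R.
Proof.
have e1 : 0 < 1 - p^-1 by rewrite subr_gt0 invf_lt1.
rewrite -[ltRHS](powRr1 (ler0n _ 2)) -[X in _ < _ `^ X](subrK p^-1) powRD_gt0//.
rewrite ltr_pMl ?powR_gt0//.
apply: (@le_lt_trans _ _ (1 `^ (1 - p^-1))); first by rewrite powR1.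
by rewrite gt0_ltr_powR// ?nnegrE// ltr1n.
Qed.

Let shift_le (m : int) : n (shift H m) <= n (shift H 1) * (`|m|%N)%:R.
Proof.
have pos (k : nat) : n (shift H k) <= n (shift H 1) * k%:R.
  elim: k => [|k IH]; first by rewrite shift0 (displacement1 dn) mulr0.
  rewrite intS shiftD -natr1 mulrDr mulr1 addrC.
  by apply: le_trans (displacementM _ _ dn) _; rewrite lerD2l.
case: m => k; first exact: pos.
have -> : shift H (Negz k) = (shift H k.+1)^-1%g.
  by apply: (@mulIg _ (shift H k.+1)); rewrite mulVg -shiftD NegzE addNr.
by rewrite (displacementV _ dn); exact: pos.
Qed.

(* Doubling: the copy of the previous element translated by [2 ^ k] commutes with
   it, and by roundness the copy or its inverse can be appended at a cost of at
   most the p-th root of the sum of the p-th powers. *)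
Lemma spread_element (h : H) (k : nat) : exists x : wreath H,
  [/\ x.2 = 0,
      forall i, lamps_fun x.1 i != 1%g -> 0 <= i < (2 ^ k)%N%:Z,
      forall i : nat, (i < 2 ^ k)%N ->
        word_length genS (lamps_fun x.1 i) = word_length genS h &
      n x <= (2 ^+ k) `^ p^-1 * n (at0 h) + D * 2 ^+ k].
Proof.
have N0 x : 0 <= n x by exact: displacement_ge0 dn.
have D0 : 0 <= D by rewrite divr_ge0 ?mulr_ge0// subr_ge0 ltW.
elim: k => [|k [x [x2 xs xl xn]]].
  exists (at0 h); split => //.
  - by move=> i; case: (eqVneq i 0) => [->//|i0]; rewrite lampE (negPf i0) eqxx.
  - by move=> i; rewrite expn0 ltnS leqn0 => /eqP ->; rewrite lampE eqxx.
  - by rewrite expr0 powR1 mul1r lerDl mulr1.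
pose y := (shift H (2 ^ k)%N * x * shift H (- (2 ^ k)%N%:Z))%g.
have y2 : y.2 = 0 by rewrite !wreath_mul2E x2 /= addr0 subrr.
have yE i : lamps_fun y.1 i = lamps_fun x.1 (i - (2 ^ k)%N%:Z).
  by rewrite 2!wreath_mul1E !lamps1E mul1g mulg1.
have ny : n y <= n x + 2 * n (shift H 1) * 2 ^+ k.
  have s1 := shift_le (2 ^ k)%N; have s2 := shift_le (- (2 ^ k)%N%:Z).
  have e : (`|(2 ^ k)%N%:Z|%N)%:R = 2 ^+ k :> R by rewrite absz_nat natrX.
  rewrite abszN in s2; rewrite !e in s1 s2.
  apply: le_trans (displacementM _ _ dn) _.
  apply: le_trans (lerD (displacementM _ _ dn) (lexx _)) _; lra.
clearbody y.
have xy : (x * y = y * x)%g.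
  apply: wreathP => [i|]; last by rewrite !wreath_mul2E x2 y2.
  rewrite !wreath_mul1E x2 y2 subr0 yE.
  have [->|/xs xi] := eqVneq (lamps_fun x.1 i) 1%g; first by rewrite mul1g mulg1.
  have [->|/xs yi] := eqVneq (lamps_fun x.1 (i - (2 ^ k)%N%:Z)) 1%g; first by rewrite mul1g mulg1.
  by exfalso; lia.
have [y' [y'2 y'E y'l y'n]] : exists y', [/\ y'.2 = 0,
    forall i, (lamps_fun y'.1 i == 1%g) = (lamps_fun y.1 i == 1%g),
    forall i, word_length genS (lamps_fun y'.1 i) = word_length genS (lamps_fun y.1 i) &
    n (x * y')%g `^ p <= n x `^ p + n y `^ p].
  have := displacement_roundness dn xy.
  have [h1 _|h1 h2] := leP (n (x * y)%g `^ p) (n x `^ p + n y `^ p).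
    by exists y.
  exists y^-1%g; split; last by lra.
  - by rewrite wreath_inv2E y2 oppr0.
  - by move=> i; rewrite wreath_inv1E y2 addr0 -eqg_inv invgK invg1 eq_sym.
  - by move=> i; rewrite wreath_inv1E y2 addr0 word_lengthV.
have xy'E i : lamps_fun (x * y')%g.1 i = (lamps_fun x.1 i * lamps_fun y'.1 i)%g.
  by rewrite wreath_mul1E x2 subr0.
exists (x * y')%g; split.
- by rewrite wreath_mul2E x2 y'2.
- move=> i; rewrite xy'E expnS.
  have [->|/xs xi _] := eqVneq (lamps_fun x.1 i) 1%g; last by lia.
  by rewrite mul1g y'E yE => /xs; lia.
- move=> i ik; rewrite xy'E.
  have [ik'|ik'] := ltnP i (2 ^ k).
    have -> : lamps_fun y'.1 i = 1%g.
      by apply/eqP; rewrite y'E yE; apply/negPn/negP => /xs; lia.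
    by rewrite mulg1 xl.
  have -> : lamps_fun x.1 i = 1%g by apply/eqP/negPn/negP => /xs; lia.
  rewrite mul1g y'l yE subzn// xl//.
  by rewrite expnS in ik; lia.
have : n (x * y')%g <= 2 `^ p^-1 * n x + 2 * n (shift H 1) * 2 ^+ k.
  have u0 : 0 <= 2 * n (shift H 1) * 2 ^+ k by rewrite !mulr_ge0.
  apply: (powR_le_inj p0) => //; first by rewrite addr_ge0// mulr_ge0// powR_ge0.
  apply: le_trans y'n _; apply: le_trans (powR_minkowski2 (N0 x) u0).
  by rewrite lerD2l ge0_ler_powR ?nnegrE ?(ltW p0) ?addr_ge0.
move=> /le_trans; apply.
have -> : (2 ^+ k.+1) `^ p^-1 = 2 `^ p^-1 * (2 ^+ k) `^ p^-1 :> R.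
  by rewrite exprS powRM.
have De : D * (2 - 2 `^ p^-1) = 2 * n (shift H 1).
  by rewrite /D divfK// gt_eqF// subr_gt0.
rewrite -De exprS; have : 0 <= 2 `^ p^-1 :> R by exact: powR_ge0.
move=> z0; have := ler_wpM2l z0 xn; lra.
Qed.

End SpreadElements.
End Roundness.

Section UpperBound.
Context (R : realType) (V : normedModType R) (p : R) (H : groupType).
Hypothesis p1 : 1 < p.
Hypothesis roundV : has_roundness V p.
Context (S : seq H) (genS : generates S).
Context (S' : seq (wreath H)) (genS' : generates S').
Local Notation len h := ((word_length genS h)%:R : R).

Let p0 : 0 < p. Proof. exact: lt_trans p1. Qed.
Let q0 : 0 < 1 - p^-1. Proof. by rewrite subr_gt0 invf_lt1. Qed.

Lemma spread_bound (n : wreath H -> R) (alpha c : R) : displacement V n ->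
  0 <= alpha -> 0 < c ->
  (forall x, (0 < word_length genS' x)%N -> c * (word_length genS' x)%:R `^ alpha <= n x) ->
  exists C E : R, [/\ 0 < C, 0 <= E & forall h, (0 < word_length genS h)%N ->
    forall k, C * (2 ^+ k * len h) `^ alpha <=
      (2 ^+ k) `^ p^-1 * n (at0 h) + E * 2 ^+ k].
Proof.
move=> dn a0 c0 nc.
have [L L0 Llen] := lamp_sum_le_length R genS genS'.
exists (c / L `^ alpha), (2 * n (shift H 1) / (2 - 2 `^ p^-1)); split.
- by rewrite divr_gt0// powR_gt0.
- rewrite divr_ge0 ?mulr_ge0 ?(displacement_ge0 _ dn)// subr_ge0.
  by rewrite -[leRHS](powRr1 (ler0n _ 2)) ler_powR ?ler1n// invf_le1// ltW.
move=> h h0 k.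
have [x [x2 xs xl xn]] := spread_element p1 roundV dn genS h k.
apply: le_trans xn.
have xsum : lamp_sum (fun h => len h) x.1 = 2 ^+ k * len h.
  have len1 : len 1%g = 0 by rewrite word_length1.
  rewrite (lamp_sumE (N := fun h => len h) (s := [seq Posz i | i <- iota 0 (2 ^ k)]) len1).
  - rewrite big_map (eq_big_seq (fun=> len h)); last first.
      by move=> i; rewrite mem_iota add0n => /andP[_ ik]; rewrite xl.
    by rewrite big_const_seq count_predT iter_addr_0 size_iota -(mulr_natl (len h)) natrX.
  - by rewrite map_inj_uniq ?iota_uniq// => i j [].
  - move=> i /xs /andP[i0 ik]; apply/mapP; exists (absz i); last by rewrite gez0_abs.
    by rewrite mem_iota add0n; lia.
have lx := Llen x; rewrite xsum in lx.
have x0 : (0 < word_length genS' x)%N.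
  rewrite lt0n; apply: contraTN lx => /eqP ->; rewrite mulr0 -ltNge.
  by rewrite mulr_gt0 ?exprn_gt0// ltr0n.
apply: le_trans (nc _ x0).
rewrite mulrAC -mulrA ler_pM2l// ler_pdivrMr ?powR_gt0// mulrC -powRM ?(ltW L0)//.
rewrite ge0_ler_powR ?nnegrE ?mulr_ge0 ?exprn_ge0 ?(ltW L0)//.
by rewrite mulrC (mulrC _ L).
Qed.

Lemma exp2_bracket (X : R) : 1 <= X -> exists k, X <= 2 ^+ k <= 2 * X.
Proof.
move=> X1; have ex : exists k, X <= 2 ^+ k.
  exists (Num.truncn X).+1; apply: ltW; apply: lt_trans (truncnS_gt _) _.
  by rewrite -natrX ltr_nat ltn_expl.
case: (ex_minnP ex) => -[|k] kX kmin; first by exists 0%N; rewrite kX expr0; lra.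
exists k.+1; rewrite kX/= exprS ler_pM2l// ltW// ltNge.
by apply/negP => /kmin; rewrite ltnn.
Qed.

(** Once 2^k reaches M^(1 / (1 - 1/p)), the lamp cost in [spread_bound] is absorbed by 2^k. A
    separate [M] is needed because [N] may be below 1. *)
Lemma scale_choice (N M : R) : N <= M -> 1 <= M -> exists k,
  (2 ^+ k) `^ p^-1 * N <= 2 ^+ k /\ 2 ^+ k <= 2 * M `^ (1 - p^-1)^-1 :> R.
Proof.
move=> NM M1; have M0 : 0 < M by lra.
have X1 : 1 <= M `^ (1 - p^-1)^-1.
  apply: (@le_trans _ _ (1 `^ (1 - p^-1)^-1)); first by rewrite powR1.
  by rewrite ge0_ler_powR ?nnegrE ?invr_ge0 ?(ltW q0)//; lra.
have [k /andP[kX kX2]] := exp2_bracket X1; exists k; split => //.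
have K0 : 0 < 2 ^+ k :> R by rewrite exprn_gt0.
rewrite -[leRHS](powRr1 (ltW K0)) -[X in _ <= _ `^ X](subrK p^-1) powRD_gt0// mulrC.
rewrite ler_wpM2r ?powR_ge0// (le_trans NM)//.
have -> : M = (M `^ (1 - p^-1)^-1) `^ (1 - p^-1).
  by rewrite -powRrM mulVf ?gt_eqF// powRr1 ?ltW.
by rewrite ge0_ler_powR ?nnegrE ?powR_ge0 ?(ltW q0) ?(ltW K0).
Qed.

(** If alpha >= 1, the spread elements at a scale given by [scale_choice] yield C |h| <= 1 + E,
    whereas lengths in [H] are unbounded. *)
Lemma admissible_wreath_lt1 alpha : infinite_set [set: H] -> 0 <= alpha ->
  admissible V genS' alpha -> alpha < 1.
Proof.
move=> Hinf a0 [n dn [c c0 nc]].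
have [C [E [C0 E0 CE]]] := spread_bound dn a0 c0 nc.
rewrite ltNge; apply/negP => a1.
have [h hC] := word_length_unbounded genS Hinf (Num.truncn ((E + 1) / C)).+2.
have h0 : (0 < word_length genS h)%N by exact: leq_trans hC.
have h1 : 1 <= len h by rewrite ler1n.
have hEC : E + 1 < C * len h.
  rewrite -ltr_pdivrMl// mulrC; apply: lt_le_trans (truncnS_gt _) _.
  by rewrite ler_nat; apply: leq_trans hC.
have N0 : 0 <= n (at0 h) by exact: displacement_ge0 dn.
have [||k [kN _]] := @scale_choice (n (at0 h)) (Num.max 1 (n (at0 h))).
- by rewrite le_max lexx orbT.
- by rewrite le_max lexx.
have K0 : 0 < 2 ^+ k :> R by rewrite exprn_gt0.
have := CE h h0 k; apply/negP; rewrite -ltNge.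
apply: (@lt_le_trans _ _ (C * (2 ^+ k * len h))).
  by have := hEC; rewrite -(ltr_pM2l K0); lra.
rewrite ler_pM2l// -[leLHS]powRr1 ?mulr_ge0 ?(ltW K0)// ler_powR//.
by rewrite mulr_ege1// exprn_ege1// ler1n.
Qed.

Lemma admissible_wreath_upper alpha : infinite_set [set: H] -> 0 <= alpha ->
  admissible V genS' alpha ->
  admissible V genS (alpha * (1 - p^-1) / (1 - alpha)).
Proof.
move=> Hinf a0 aa; have a1 := admissible_wreath_lt1 Hinf a0 aa.
have [n dn [c c0 nc]] := aa.
have [C [E [C0 E0 CE]]] := spread_bound dn a0 c0 nc.
have d0 : 0 < 1 - alpha by rewrite subr_gt0.
set q := 1 - p^-1; have qp : 0 < q := q0.
(* Since N >= c, this factor makes F N at least 1 and at least N, as [scale_choice] requires. *)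
pose F := Num.max 1 c^-1.
have F1 : 1 <= F by rewrite le_max lexx.
have F0 : 0 < F by lra.
pose B := (1 + E) / C * (2 * F `^ q^-1) `^ (1 - alpha).
have B0 : 0 < B.
  by rewrite mulr_gt0 ?divr_gt0 ?powR_gt0 ?mulr_gt0 ?powR_gt0//; lra.
exists (n \o @at0 H); first exact: displacement_comp (at01 H) (@at0M H) dn.
exists (B `^ (q / (1 - alpha)))^-1; first by rewrite invr_gt0 powR_gt0.
move=> h h0; rewrite ler_pdivrMl ?powR_gt0//=.
have r1 : 1 <= len h by rewrite ler1n.
set N := n (at0 h).
have cN : c <= N.
  have x0 := length_at0_gt0 genS' h0.
  apply: le_trans (nc _ x0); rewrite ler_peMr ?(ltW c0)//.
  apply: (@le_trans _ _ (1 `^ alpha)); first by rewrite powR1.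
  by rewrite ge0_ler_powR ?nnegrE ?ler1n.
have N0 : 0 < N by exact: lt_le_trans cN.
have [||k [kN kM]] := @scale_choice N (F * N).
- by rewrite ler_peMl// ltW.
- have <- : c^-1 * c = 1 by rewrite mulVf ?gt_eqF.
  by rewrite ler_pM ?invr_ge0 ?(ltW c0)// le_max lexx orbT.
have K0 : 0 < 2 ^+ k :> R by rewrite exprn_gt0.
have rB : len h `^ alpha <= B * N `^ ((1 - alpha) / q).
  have h1 : C * (2 ^+ k * len h) `^ alpha <= (1 + E) * 2 ^+ k.
    by apply: le_trans (CE h h0 k) _; rewrite -/N; lra.
  have h2 : len h `^ alpha <= (1 + E) / C * (2 ^+ k) `^ (1 - alpha).
    rewrite -(ler_pM2l (mulr_gt0 C0 (powR_gt0 alpha K0))) -mulrA -powRM ?(ltW K0)//.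
    apply: le_trans h1 _; rewrite le_eqVlt; apply/orP; left; apply/eqP.
    have Ke : (2 ^+ k) `^ alpha * (2 ^+ k) `^ (1 - alpha) = 2 ^+ k :> R.
      by rewrite -powRD_gt0// subrKC powRr1// ltW.
    by rewrite -[in LHS]Ke; field; rewrite gt_eqF.
  apply: le_trans h2 _; rewrite /B -(mulrA ((1 + E) / C)) ler_pM2l; last by rewrite divr_gt0//; lra.
  apply: (@le_trans _ _ ((2 * (F * N) `^ q^-1) `^ (1 - alpha))).
    by rewrite ge0_ler_powR ?nnegrE ?(ltW d0) ?(ltW K0) ?mulr_ge0 ?powR_ge0.
  rewrite (powRM _ (ltW F0) (ltW N0)) mulrA powRM ?mulr_ge0 ?powR_ge0//.
  by rewrite -powRrM (mulrC q^-1).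
have -> : alpha * q / (1 - alpha) = alpha * (q / (1 - alpha)) by rewrite mulrA.
rewrite powRrM.
have -> : B `^ (q / (1 - alpha)) * N = (B * N `^ ((1 - alpha) / q)) `^ (q / (1 - alpha)).
  rewrite powRM ?powR_ge0 ?(ltW B0)// -powRrM.
  have -> : (1 - alpha) / q * (q / (1 - alpha)) = 1 by field; rewrite !gt_eqF.
  by rewrite powRr1// ltW.
have e0 : 0 <= q / (1 - alpha) by apply: divr_ge0; exact: ltW.
have BN0 : 0 <= B * N `^ ((1 - alpha) / q) by rewrite mulr_ge0 ?powR_ge0 ?(ltW B0).
by rewrite ge0_ler_powR ?nnegrE ?powR_ge0.
Qed.

End UpperBound.

(** * The exponent *)

(** The last inequality means z t <= delta (beta - z). The hypotheses give z t < beta - z, so the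
    thresholds z and z t / (beta - z) are both below 1, and [delta] is the midpoint between their
    maximum and 1. *)
Lemma scale_exponent (R : realType) (p beta z : R) : 0 < z -> z < 1 -> z < beta ->
  z * (1 - p^-1) < beta * (1 - z) ->
  exists delta, [/\ 0 < delta, delta < 1, z <= delta &
    z * (1 + Num.max 0 (beta - p^-1) / delta) <= beta].
Proof.
move=> z0 z1 zb zq; set t := Num.max 0 (beta - p^-1).
have t0 : 0 <= t by rewrite le_max lexx.
have bz : 0 < beta - z by rewrite subr_gt0.
have zt : z * t < beta - z.
  rewrite /t; have [_|_] := leP 0 (beta - p^-1); last by rewrite mulr0.
  by move: zq; rewrite !mulrBr !mulr1 (mulrC beta z); lra.
pose m := Num.max z (z * t / (beta - z)).
have zm : z <= m by rewrite le_max lexx.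
have tm : z * t / (beta - z) <= m by rewrite le_max lexx orbT.
have m1 : m < 1 by rewrite gt_max z1 ltr_pdivrMr// mul1r.
have d0 : 0 < (1 + m) / 2 by lra.
exists ((1 + m) / 2); split; [by []|lra|lra|].
have : z * t <= (1 + m) / 2 * (beta - z).
  by rewrite -ler_pdivrMr// (le_trans tm)//; lra.
move=> h; rewrite mulrDr mulr1 addrC -lerBrDr mulrA ler_pdivrMr// mulrC.
by rewrite mulrC (mulrC (beta - z)).
Qed.

(* The exponents do not depend on the finite generating sets defining the word
   metrics; S and S' are arbitrary finite generating sets of H and H wr Z. *)
Theorem theorem1p6 (R : realType) (p : R) (p1 : 1 <= p) (p2 : p <= 2)
    (H : groupType) (S : seq H) (genS : generates S)
    (Hinfinite : infinite_set [set: H])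
    (S' : seq (wreath H)) (genS' : generates S') :
  let a : \bar R := alpha_sharp p1 genS in
  alpha_sharp p1 genS' =
    mine (if (p == 1) && (a == 0%E) then 1%E
          else (a / (a + (1 - p^-1)%:E))%E)
         a.
Proof.
move=> a; rewrite /alpha_sharp equivariant_exponentE.
set B := _ `|` _ : set (\bar R).
set A := [set 0%E] `|` [set alpha%:E | alpha in
    [set alpha : R | 0 <= alpha /\ admissible (Lp01 p1) genS alpha]].
have aE : a = ereal_sup A by exact: equivariant_exponentE.
have p0 : 0 < p by lra.
have q0 : 0 <= 1 - p^-1 by rewrite subr_ge0 invf_le1.
have a0 : (0 <= a)%E by rewrite aE; apply: ereal_sup_ubound; left.
have a1 : (a <= 1)%E.
  rewrite aE; apply: ge_ereal_sup => _ [->|[alpha [al0 al] <-]]; first exact: lee01.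
  by rewrite lee_fin; exact: admissible_le1 al.
have [x ax] : exists x, a = x%:E.
  by exists (fine a); rewrite fineK// fin_real// (lt_le_trans _ a0)//= (le_lt_trans a1)// ltry.
rewrite ax in a0 a1 *; move: a0 a1; rewrite !lee_fin => x0 x1.
set q := 1 - p^-1 in q0 *.
pose y := Num.min (if (p == 1) && (x == 0) then 1 else x / (x + q)) x.
have pq : p != 1 -> 0 < q.
  by move=> pn1; rewrite subr_gt0 invf_lt1// lt_neqAle eq_sym pn1.
have -> : mine (if (p == 1) && (x%:E == 0%E) then 1%E
          else (x%:E / (x%:E + q%:E))%E) x%:E = y%:E.
  rewrite /y EFin_min eqe; congr mine; case: ifPn => // h.
  have xq : x + q != 0.
    rewrite gt_eqF//; move: h; rewrite negb_and => /orP[/pq ?|xn0]; first by lra.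
    by have : 0 < x by [rewrite lt_neqAle eq_sym xn0]; lra.
  by rewrite -EFinD inver (negPf xq) -EFinM.
have admH alpha : 0 <= alpha -> admissible (Lp01 p1) genS alpha -> alpha <= x.
  move=> al0 al; rewrite -lee_fin -ax aE; apply: ereal_sup_ubound; right.
  by exists alpha.
have roundV := @Lp01_roundness R p p1 p2.
apply/eqP; rewrite eq_le; apply/andP; split.
  apply: ge_ereal_sup => _ [->|[alpha [al0 al] <-]]; rewrite lee_fin.
    rewrite /y le_min x0 andbT; case: ifP => // _.
    by rewrite divr_ge0// addr_ge0.
  have alx : alpha <= x by apply: admH => //; exact: admissible_restrict al.
  rewrite /y le_min alx andbT; case: ifPn => [_|h].
    exact: le_trans alx _.
  (* For p = 1 the fraction is x / x = 1, and alpha <= x <= 1 is enough. *)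
  have [pE1|pn1] := eqVneq p 1.
    have qE : q = 0 by rewrite /q pE1 invr1 subrr.
    move: h; rewrite pE1 eqxx /= qE addr0 => xn0.
    by rewrite divff// (le_trans alx).
  have qp := pq pn1.
  have p1' : 1 < p by rewrite lt_neqAle eq_sym pn1.
  have al1 := admissible_wreath_lt1 p1' roundV genS Hinfinite al0 al.
  have := admissible_wreath_upper p1' roundV genS Hinfinite al0 al.
  have e0 : 0 <= alpha * (1 - p^-1) / (1 - alpha).
    by rewrite divr_ge0 ?mulr_ge0// subr_ge0 ltW.
  move=> /(admH _ e0).
  rewrite ler_pdivrMr ?subr_gt0// ler_pdivlMr; last by lra.
  rewrite -/q; lra.
have sup0 : (0 <= ereal_sup B)%E by apply: ereal_sup_ubound; left.
rewrite leNgt; apply/negP => By.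
have [z zE] : exists z, ereal_sup B = z%:E.
  by exists (fine (ereal_sup B)); rewrite fineK// fin_real// (lt_le_trans _ sup0)//= (lt_trans By)// ltry.
rewrite zE in By sup0; rewrite !lte_fin lee_fin in By sup0.
(* A value strictly between the supremum and the claimed exponent leaves room both for delta < 1 and
   for the supremum over [H] not being attained. *)
pose w := (z + y) / 2.
have w0 : 0 < w by rewrite /w; lra.
have wy : w < y by rewrite /w; lra.
have zw : z < w by rewrite /w; lra.
have wx : w < x by apply: lt_le_trans wy _; rewrite ge_min lexx orbT.
have w1 : w < 1 by exact: lt_le_trans wx _.
have wq : w * q < x * (1 - w).
  have xp : 0 < x by lra.
  have xq : 0 < x + q by lra.
  have : w < x / (x + q).
    apply: lt_le_trans wy _; rewrite /y (gt_eqF xp) andbF.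
    by rewrite ge_min lexx.
  by rewrite ltr_pdivlMr//; lra.
(* The two lower bounds on [beta] are the hypotheses of [scale_exponent] solved for [beta]; both are
   strictly below x, so some admissible exponent of [H] exceeds them. *)
have [beta [bt0 bt] wb] : exists2 beta, 0 <= beta /\ admissible (Lp01 p1) genS beta &
    Num.max w (w * q / (1 - w)) < beta.
  have /ereal_sup_gt : ((Num.max w (w * q / (1 - w)))%:E < ereal_sup A)%E.
    by rewrite -aE ax lte_fin gt_max wx ltr_pdivrMr// subr_gt0.
  move=> [_ [->|[beta bt <-]]]; rewrite lte_fin; last by exists beta.
  by rewrite gt_max => /andP[]; lra.
move: wb; rewrite gt_max => /andP[wb]; rewrite ltr_pdivrMr ?subr_gt0// => wqb.
have [delta [d0 d1 wd wdb]] := scale_exponent w0 w1 wb wqb.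
have : (w%:E <= ereal_sup B)%E.
  apply: ereal_sup_ubound; right; exists w => //; split; first exact: ltW.
  have bt1 : 0 < beta := lt_trans w0 wb.
  have := wreath_admissible p1 (Lp01_divisible p1) (Lp01_unit_vector p1) genS'.
  by move=> /(_ _ _ w beta delta d0 d1 bt1 (ltW w0) wd wdb bt).
by rewrite zE lee_fin leNgt zw.
Qed.
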